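(* Let $p>0$ be a prime. The ring $R_\infty\otimes\mathbb{Q}$ is $0$-dimensional (Krull dimension). Its spectrum is homeomorphic, as a topological space, to $Y=\varprojlim_\nu Y_\nu$, and this is the Alexandroff (one-point) compactification of the discrete space $\{y_0,y_1,\ldots\}$ obtained by putting the point $y_\infty$ at ''infinity''.
   Context: The convolution ring $R$ in characteristic $p$: let $k$ be a field of characteristic $p$ and consider the category of pairs $(V,\varphi)$, where $V$ is a finite-dimensional $k$-vector space and $\varphi$ is a nilpotent endomorphism. $R$ is the free abelian group on isomorphism classes of such pairs modulo the relations $[V]=[V']+[V'']$ coming from direct sum decompositions. As an abelian group it is free on the classes $f_n$, $n\geq 1$, of $k^n$ with the nilpotent Jordan block $J_n$ of size $n$. Multiplication is induced by sending $(V,\varphi),(V',\varphi')$ to $V\otimes_k V'$ with the endomorphism $\varphi\otimes\mathrm{id}+\mathrm{id}\otimes\varphi'$; the unit is $f_1=1$ and $R$ depends only on $p$. For $\nu\geq 0$, $R_\nu\subset R$ is the subgroup generated by $f_1,f_p,\ldots,f_{p^\nu}$, which is a subring, and $R_\infty=\bigcup_{\nu\geq 0}R_\nu\subset R$, which is a free $\mathbb{Z}$-module on all $f_{p^i}$, $i\geq 0$. Set $Y_\nu=\mathrm{Spec}(\prod_{i=0}^{\nu}\mathbb{Q})$, a discrete space with points $y^\nu_0,\ldots,y^\nu_\nu$, where $y_i^\nu$ corresponds to the $i$-th projection $\prod_{i=0}^\nu\mathbb{Q}\to\mathbb{Q}$. The transition map $Y_{\nu+1}\to Y_\nu$ is induced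 by $\prod_{i=0}^\nu\mathbb{Q}\to\prod_{i=0}^{\nu+1}\mathbb{Q}$, $(a_0,\ldots,a_\nu)\mapsto(a_0,\ldots,a_\nu,a_\nu)$; it sends $y_i^{\nu+1}\mapsto y_i^\nu$ for $i\leq\nu$ and $y_{\nu+1}^{\nu+1}\mapsto y_\nu^\nu$. The inverse limit $Y=\varprojlim Y_\nu\subset\prod_\nu Y_\nu$ (with the inverse limit topology) consists of the points $y_i=(y_0^0,y_1^1,\ldots,y_i^i,y_i^{i+1},y_i^{i+2},\ldots)$, $i\geq 0$, together with $y_\infty=(y_0^0,y_1^1,y_2^2,\ldots)$. *)

(* Defs.v *)
From HB Require Import structures.
From mathcomp Require Import all_boot all_order all_algebra generic_quotient.
From mathcomp Require Import ring_quotient.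
From mathcomp Require Import all_classical topology function_spaces.
From mathcomp.real_closed Require Import mxtens.
From mathcomp.multinomials Require Import freeg.
From mathcomp Require Import zify.

Set Implicit Arguments.
Unset Strict Implicit.
Unset Printing Implicit Defensive.

Import GRing.Theory.
Local Open Scope ring_scope.
Local Open Scope quotient_scope.
Local Open Scope classical_set_scope.

Section Zspan.
Variables (G : zmodType) (S : set G).

(* The subgroup of G generated by S. *)
Definition zspan : set G :=
  smallest [set H | H 0 /\ forall x y, H x -> H y -> H (x - y)] S.

Lemma zspan_gen : S `<=` zspan.
Proof. exact: sub_gen_smallest. Qed.

Lemma zspan0 : zspan 0.
Proof. by move=> H [[]]. Qed.

Lemma zspanB x y : zspan x -> zspan y -> zspan (x - y).
Proof.
move=> hx hy H [[H0 HB] SH]; have hH : (forall x y, H x -> H y -> H (x - y)) by [].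
by apply: hH; [apply: (hx H)|apply: (hy H)].
Qed.

Lemma zspanN x : zspan x -> zspan (- x).
Proof. by rewrite -sub0r; apply: zspanB; apply: zspan0. Qed.

Lemma zspanD x y : zspan x -> zspan y -> zspan (x + y).
Proof. by move=> hx /zspanN; rewrite -{2}[y]opprK; apply: zspanB. Qed.

Lemma zspan_min (H : set G) : H 0 -> (forall x y, H x -> H y -> H (x - y)) ->
  S `<=` H -> zspan `<=` H.
Proof. by move=> H0 HB; apply: smallest_sub. Qed.

Definition zspan_pred : pred G := fun x => `[< zspan x >].

Lemma zspan_pred_closed : zmod_closed zspan_pred.
Proof.
split; first by apply/asboolP; apply: zspan0.
by move=> x y /asboolP hx /asboolP hy; apply/asboolP; apply: zspanB.
Qed.
HB.instance Definition _ := GRing.isZmodClosed.Build G zspan_pred zspan_pred_closed.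

Definition zspan_sub : zmodClosed G := GRing.ZmodClosed.clone G zspan_pred _.

End Zspan.

(* A commutative ring presented additively: the free abelian group on the
   commutative monoid (pgen, pmul, pone), modulo the subgroup generated by prel,
   with the multiplication induced by pmul.  By prelM that subgroup is an ideal
   of the monoid ring, so the multiplication descends to the quotient. *)
Record ringPres := RingPres {
  pgen : choiceType;
  pone : pgen;
  pmul : pgen -> pgen -> pgen;
  pmulA : associative pmul;
  pmulC : commutative pmul;
  pmul1 : left_id pone pmul;
  prel : set {freeg pgen};
  prelM : forall x d, prel d ->
    zspan prel (fglift (fun y => << pmul x y >> : {freeg pgen}) d)
}.

Arguments prel : clear implicits.

Definition presRing (P : ringPres) : Type := {ideal_quot (zspan_sub (prel P))}.

HB.instance Definition _ (P : ringPres) := GRing.Zmodule.on (presRing P).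

Section PresRing.
Variable P : ringPres.
Local Notation X := (pgen P).
Local Notation Q := (presRing P).

(* The class of a generator. *)
Definition pclass (x : X) : Q := \pi_({ideal_quot (zspan_sub (prel P))}) << x >>.

Lemma freeg_zmod_ext (G : zmodType) (g h : {freeg X} -> G) :
  zmod_morphism g -> zmod_morphism h ->
  (forall x, g << x >> = h << x >>) -> g =1 h.
Proof.
move=> gB hB gh D.
pose gm := GRing.isZmodMorphism.Build _ _ g gB.
pose g' : {additive {freeg X} -> G} := HB.pack g gm.
pose hm := GRing.isZmodMorphism.Build _ _ h hB.
pose h' : {additive {freeg X} -> G} := HB.pack h hm.
rewrite -[D]freeg_sumE -[g]/(g' : _ -> _) -[h]/(h' : _ -> _) !raddf_sum.
apply: eq_bigr => x _; rewrite -[coeff x D]intz -freegU_mulz !raddfMz.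
by congr (_ *~ _); apply: gh.
Qed.

Lemma pclass_ext (G : zmodType) (g h : Q -> G) :
  zmod_morphism g -> zmod_morphism h ->
  (forall x, g (pclass x) = h (pclass x)) -> g =1 h.
Proof.
move=> gB hB gh q; rewrite -[q]reprK.
apply: (@freeg_zmod_ext G (g \o \pi_{ideal_quot (zspan_sub (prel P))})
  (h \o \pi_{ideal_quot (zspan_sub (prel P))})) => [x y|x y|x] /=; last exact: gh.
- by rewrite raddfB; apply: gB.
- by rewrite raddfB; apply: hB.
Qed.

Section Lift.
Variables (G : zmodType) (f : X -> G).

Definition flift (d : {freeg X}) : G := fglift (f : X -> zmodule G) d.

Lemma fliftB : zmod_morphism flift.
Proof. exact: (@lift_is_additive _ _ (zmodule G)). Qed.

Lemma fliftE x : flift << x >> = f x.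
Proof. by rewrite /flift liftU scale1r. Qed.

Definition plift (q : Q) : G := flift (repr (q : {ideal_quot (zspan_sub (prel P))})).

Hypothesis f0 : forall d, prel P d -> flift d = 0.

Lemma flift0 : flift 0 = 0.
Proof. by have := fliftB 0 0; rewrite !subrr. Qed.

Lemma flift_span d : zspan (prel P) d -> flift d = 0.
Proof.
move: d; apply: zspan_min => //; first exact: flift0.
by move=> x y hx hy; rewrite fliftB hx hy subrr.
Qed.

Lemma plift_pi d : plift (\pi_({ideal_quot (zspan_sub (prel P))}) d) = flift d.
Proof.
apply/eqP; rewrite -subr_eq0 -fliftB; apply/eqP/flift_span/asboolP.
suff : (repr (\pi_({ideal_quot (zspan_sub (prel P))}) d) - d) \in zspan_sub (prel P) by [].
by rewrite Quotient.idealrBE reprK.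
Qed.

Lemma pliftB : zmod_morphism plift.
Proof.
move=> q r; rewrite -[q]reprK -[r]reprK -[_ - _]raddfB.
by rewrite !plift_pi fliftB.
Qed.

Lemma pliftE x : plift (pclass x) = f x.
Proof. by rewrite plift_pi fliftE. Qed.

End Lift.

Lemma pi_span d : zspan (prel P) d -> \pi_({ideal_quot (zspan_sub (prel P))}) d = 0.
Proof.
move=> hd; rewrite -(raddf0 (\pi_({ideal_quot (zspan_sub (prel P))}))).
by apply/eqP; rewrite -Quotient.idealrBE subr0; apply/asboolP.
Qed.

Definition pmull (x : X) : Q -> Q := plift (fun y => pclass (pmul x y)).

Lemma flift_mull x d : flift (fun y => pclass (pmul x y)) d =
  \pi_({ideal_quot (zspan_sub (prel P))})
     (fglift (fun y => << pmul x y >> : {freeg X}) d).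
Proof.
apply: (@freeg_zmod_ext _ (flift (fun y => pclass (pmul x y)))
  (fun d => \pi_({ideal_quot (zspan_sub (prel P))})
     (fglift (fun y => << pmul x y >> : {freeg X}) d))) => [|a b|y].
- exact: fliftB.
- by rewrite -[RHS]raddfB lift_is_additive.
- by rewrite fliftE liftU scale1r.
Qed.

Lemma pmull_wd x d : prel P d -> flift (fun y => pclass (pmul x y)) d = 0.
Proof. by move=> hd; rewrite flift_mull pi_span//; apply: prelM. Qed.

Lemma pmullE x y : pmull x (pclass y) = pclass (pmul x y).
Proof. by rewrite /pmull pliftE//; apply: pmull_wd. Qed.

Lemma pmullB x : zmod_morphism (pmull x).
Proof. by apply: pliftB; apply: pmull_wd. Qed.

Definition pres_mul (a b : Q) : Q := plift (fun x => pmull x b) a.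

Lemma pres_mul_wd b d : prel P d -> flift (fun x => pmull x b) d = 0.
Proof.
move=> hd; move: b.
apply: (@pclass_ext _ (fun b => flift (fun x => pmull x b) d) (fun=> 0)).
- move=> a b.
  apply: (@freeg_zmod_ext _ (flift (fun x => pmull x (a - b)))
    (fun d => flift (fun x => pmull x a) d - flift (fun x => pmull x b) d)).
  + exact: fliftB.
  + by move=> u v; rewrite !fliftB !opprD !opprK addrACA.
  + by move=> x; rewrite !fliftE pmullB.
- by move=> a b; rewrite subr0.
move=> y; rewrite -[RHS](@pmull_wd y _ hd).
by congr (flift _ d); apply: funext => x; rewrite pmullE pmulC.
Qed.

Lemma pres_mulE x y : pres_mul (pclass x) (pclass y) = pclass (pmul x y).
Proof. by rewrite /pres_mul pliftE ?pmullE// => d; apply: pres_mul_wd. Qed.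

Lemma pres_mulBl b : zmod_morphism (pres_mul^~ b).
Proof. by apply: pliftB => d; apply: pres_mul_wd. Qed.

Lemma pres_mulBr a : zmod_morphism (pres_mul a).
Proof.
move=> b c; move: a.
apply: (@pclass_ext _ (fun a => pres_mul a (b - c))
  (fun a => pres_mul a b - pres_mul a c)); first exact: pres_mulBl.
  move=> u v; rewrite !pres_mulBl.
  by rewrite !opprD !opprK addrACA.
move=> x; rewrite /pres_mul !pliftE ?pmullB//; by move=> d; apply: pres_mul_wd.
Qed.

Lemma pres_mulC : commutative pres_mul.
Proof.
move=> a b; move: a.
apply: (@pclass_ext _ (pres_mul^~ b) (pres_mul b));
  [exact: pres_mulBl|exact: pres_mulBr|move=> x].
move: b; apply: (@pclass_ext _ (pres_mul _) (pres_mul^~ _));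
  [exact: pres_mulBr|exact: pres_mulBl|move=> y].
by rewrite !pres_mulE pmulC.
Qed.

Lemma pres_mul1 : left_id (pclass (pone P)) pres_mul.
Proof.
apply: (@pclass_ext _ (pres_mul _) id); [exact: pres_mulBr|by []|move=> x].
by rewrite pres_mulE pmul1.
Qed.

Lemma pres_mulA : associative pres_mul.
Proof.
move=> a b c; move: a.
apply: (@pclass_ext _ (fun a => pres_mul a (pres_mul b c))
  (fun a => pres_mul (pres_mul a b) c)).
- exact: pres_mulBl.
- by move=> u v; rewrite !pres_mulBl.
move=> x; move: b; apply: (@pclass_ext _
  (fun b => pres_mul (pclass x) (pres_mul b c))
  (fun b => pres_mul (pres_mul (pclass x) b) c)).
- by move=> u v; rewrite pres_mulBl pres_mulBr.
- by move=> u v; rewrite pres_mulBr pres_mulBl.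
move=> y; move: c; apply: (@pclass_ext _
  (fun c => pres_mul (pclass x) (pres_mul (pclass y) c))
  (fun c => pres_mul (pres_mul (pclass x) (pclass y)) c)).
- by move=> u v; rewrite !pres_mulBr.
- by move=> u v; rewrite !pres_mulBr.
by move=> z; rewrite !pres_mulE pmulA.
Qed.

Lemma pres_mulDl : left_distributive pres_mul +%R.
Proof.
move=> a b c; have mB := pres_mulBl c.
have m0 : pres_mul 0 c = 0 by rewrite -[X in pres_mul X c](subrr 0) mB /= subrr.
by rewrite -{1}[b]opprK mB /= -[- b]sub0r mB /= m0 sub0r opprK.
Qed.

HB.instance Definition _ := GRing.Zmodule_isComPzRing.Build (presRing P)
  pres_mulA pres_mulC pres_mul1 pres_mulDl.

End PresRing.

Lemma nilp_commD (R : pzRingType) (x y : R) (M N : nat) : GRing.comm x y ->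
  x ^+ M = 0 -> y ^+ N = 0 -> (x + y) ^+ (M + N) = 0.
Proof.
move=> cxy xM yN; rewrite exprDn_comm// big1// => i _.
have [Ni|iN] := leqP N i.
  by rewrite -(subnKC Ni) exprD yN mul0r mulr0 mul0rn.
have -> : (M + N - i = M + (N - i))%N by rewrite addnBA// ltnW.
by rewrite exprD xM !mul0r mul0rn.
Qed.

Lemma pchar_commXD (R : pzRingType) (p : nat) : prime p -> p%:R = 0 :> R ->
  forall (x y : R) e, GRing.comm x y ->
  (x + y) ^+ (p ^ e) = x ^+ (p ^ e) + y ^+ (p ^ e).
Proof.
move=> p_pr p0 x y e cxy.
have frob u v : GRing.comm u v -> (u + v) ^+ p = u ^+ p + v ^+ p :> R.
  move=> cuv; case: p p_pr p0 => // p p_pr p0.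
  rewrite exprDn_comm// big_ord_recr big_ord_recl/= big1 => [|i _].
    by rewrite subn0 subnn bin0 binn !expr0 mulr1 mul1r !mulr1n addr0.
  have /dvdnP[q ->] : (p.+1 %| 'C(p.+1, bump 0 i))%N by apply: prime_dvd_bin => //; apply: (ltn_ord i).
  by rewrite mulnC mulrnA -[_ *+ p.+1]mulr_natr p0 mulr0 mul0rn.
elim: e => [|e IHe]; first by rewrite !expr1.
rewrite !expnSr !exprM IHe; apply: frob.
by apply/commrX/commr_sym/commrX/commr_sym.
Qed.

Section NilEnd.
Variable k : fieldType.

(* A pair (V, phi) is represented in coordinates: V = k^ndim, and nmx is the
   matrix of phi acting on row vectors. *)
Record nilEnd := NilEnd {
  ndim : nat;
  nmx : 'M[k]_ndim;
  nmxP : exists N, nmx ^+ N = 0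
}.

HB.instance Definition _ := gen_eqMixin nilEnd.
HB.instance Definition _ := gen_choiceMixin nilEnd.

(* P is the matrix of a linear bijection V -> W with inverse Q that intertwines
   the two endomorphisms (on row vectors). *)
Definition nilEnd_iso (V W : nilEnd) : Prop :=
  exists (P : 'M[k]_(ndim V, ndim W)) (Q : 'M[k]_(ndim W, ndim V)),
    [/\ P *m Q = 1%:M, Q *m P = 1%:M & nmx V *m P = P *m nmx W].

Lemma nilEnd_iso_refl V : nilEnd_iso V V.
Proof. by exists 1%:M, 1%:M; rewrite !mulmx1 mul1mx. Qed.

Lemma nilEnd_iso_sym V W : nilEnd_iso V W -> nilEnd_iso W V.
Proof.
move=> [P [Q [PQ QP AP]]]; exists Q, P; split=> //.
by rewrite -[RHS]mulmx1 -PQ mulmxA -(mulmxA Q) AP !mulmxA QP mul1mx.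
Qed.

Lemma nilEnd_iso_trans U V W :
  nilEnd_iso U V -> nilEnd_iso V W -> nilEnd_iso U W.
Proof.
move=> [P [Q [PQ QP AP]]] [P' [Q' [PQ' QP' AP']]].
exists (P *m P'), (Q' *m Q); split.
- by rewrite mulmxA -(mulmxA P) PQ' mulmx1.
- by rewrite mulmxA -(mulmxA Q') QP mulmx1.
- by rewrite mulmxA AP -!mulmxA AP'.
Qed.

Definition nilEnd_isob : rel nilEnd := fun V W => `[< nilEnd_iso V W >].

Lemma nilEnd_isob_equiv : equiv_class_of nilEnd_isob.
Proof.
split=> [V|V W|V U W]; first exact/asboolP/nilEnd_iso_refl.
  by apply/asboolP/asboolP; apply: nilEnd_iso_sym.
by move=> /asboolP UV /asboolP VW; apply/asboolP/(nilEnd_iso_trans UV).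
Qed.
Canonical nilEnd_isob_equivRel := EquivRelPack nilEnd_isob_equiv.
Canonical nilEnd_isob_encModRel := defaultEncModRel nilEnd_isob.

Definition isoClass : Type := {eq_quot nilEnd_isob}.
HB.instance Definition _ := Choice.on isoClass.

Definition iso_class (V : nilEnd) : isoClass := \pi_({eq_quot nilEnd_isob}) V.

Lemma iso_classP V W : iso_class V = iso_class W <-> nilEnd_iso V W.
Proof.
split=> [/eqP|VW]; first by rewrite piE => /asboolP.
by apply/eqP; rewrite piE; apply/asboolP.
Qed.

Definition iso_repr (c : isoClass) : nilEnd := repr (c : {eq_quot nilEnd_isob}).

Lemma iso_reprK c : iso_class (iso_repr c) = c.
Proof. exact: reprK. Qed.

Lemma iso_reprE V : nilEnd_iso (iso_repr (iso_class V)) V.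
Proof. by apply/iso_classP; rewrite iso_reprK. Qed.

Lemma nilEnd_iso_reindex V W (f : 'I_(ndim V) -> 'I_(ndim W))
    (g : 'I_(ndim W) -> 'I_(ndim V)) : cancel f g -> cancel g f ->
  (forall i j, nmx V i j = nmx W (f i) (f j)) -> nilEnd_iso V W.
Proof.
move=> fK gK fE.
exists (\matrix_(i, j) (f i == j)%:R), (\matrix_(i, j) (g i == j)%:R).
have sumE n (F : 'I_n -> k) (i : 'I_n) : \sum_j (i == j)%:R * F j = F i.
  rewrite (bigD1 i)//= eqxx mul1r big1 ?addr0// => j ji.
  by rewrite eq_sym (negbTE ji) mul0r.
split; apply/matrixP => i j; rewrite !mxE.
- under eq_bigr do rewrite !mxE; rewrite (sumE _ (fun l => (g l == j)%:R)).
  by rewrite fK.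
- under eq_bigr do rewrite !mxE; rewrite (sumE _ (fun l => (f l == j)%:R)).
  by rewrite gK.
under [RHS]eq_bigr do rewrite !mxE; rewrite (sumE _ (fun l => nmx W l j)).
under eq_bigr do rewrite !mxE mulrC (can2_eq fK gK) eq_sym.
by rewrite (sumE _ (fun l => nmx V i l)) fE gK.
Qed.

Fact nil_dsum_subproof V W :
  exists N, (block_mx (nmx V) 0 0 (nmx W) : 'M_(ndim V + ndim W)) ^+ N = 0.
Proof.
have [M VM] := nmxP V; have [N WN] := nmxP W; exists (M + N)%N.
have -> : block_mx (nmx V) 0 0 (nmx W) ^+ (M + N) =
    block_mx (nmx V ^+ (M + N)) 0 0 (nmx W ^+ (M + N)).
  elim: (M + N)%N => [|n IHn]; first by rewrite !expr0 -!idmxE -scalar_mx_block.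
  rewrite !exprS IHn -!mulmxE (mulmx_block (nmx V)).
  by rewrite !mulmx0 !mul0mx !addr0 add0r.
by rewrite !exprD VM WN mul0r mulr0 block_mx0.
Qed.
Definition nil_dsum V W := NilEnd (nil_dsum_subproof V W).

Lemma tens11 m n : 1%:M *t 1%:M = 1%:M :> 'M[k]_(m * n).
Proof.
apply/matrixP => i j; case: (mxtens_indexP i) => i0 i1.
case: (mxtens_indexP j) => j0 j1; rewrite tensmxE !mxE.
by rewrite (can_eq (@mxtens_indexK m n)) xpair_eqE -natrM mulnb.
Qed.

Lemma tensmx1X m n (A : 'M[k]_m) N :
  (A *t 1%:M : 'M_(m * n)) ^+ N = A ^+ N *t 1%:M.
Proof.
elim: N => [|N IHN]; last by rewrite !exprS IHN -!mulmxE tensmx_mul mulmx1.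
by rewrite !expr0 -!idmxE tens11.
Qed.

Lemma tens1mxX m n (A : 'M[k]_n) N :
  (1%:M *t A : 'M_(m * n)) ^+ N = 1%:M *t A ^+ N.
Proof.
elim: N => [|N IHN]; last by rewrite !exprS IHN -!mulmxE tensmx_mul mulmx1.
by rewrite !expr0 -!idmxE tens11.
Qed.

Lemma tens_comm m n (A : 'M[k]_m) (B : 'M[k]_n) :
  GRing.comm (A *t 1%:M : 'M_(m * n)) (1%:M *t B).
Proof. by rewrite /GRing.comm -!mulmxE !tensmx_mul !mulmx1 !mul1mx. Qed.

(* phi (x) id + id (x) phi', where *t is the Kronecker product. *)
Fact nil_tens_subproof V W : exists N,
  (nmx V *t 1%:M + 1%:M *t nmx W : 'M_(ndim V * ndim W)) ^+ N = 0.
Proof.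
have [M VM] := nmxP V; have [N WN] := nmxP W; exists (M + N)%N.
apply: nilp_commD; first exact: tens_comm.
- by rewrite tensmx1X VM tens0mx.
- by rewrite tens1mxX WN tensmx0.
Qed.
Definition nil_tens V W := NilEnd (nil_tens_subproof V W).

(* On row vectors: e_i |-> e_(i+1), and the last basis vector goes to 0. *)
Definition jordan_block n : 'M[k]_n := \matrix_(i, j) (i.+1 == j)%:R.

Lemma jordan_blockX n s i j : (jordan_block n ^+ s) i j = ((i + s)%N == j)%:R.
Proof.
elim: s i j => [|s IHs] i j; first by rewrite expr0 addn0 -idmxE mxE.
rewrite exprS -mulmxE mxE.
have [iSn|niS] := ltnP i.+1 n; last first.
  rewrite big1 => [|l _]; last first.
    by rewrite mxE gtn_eqF ?mul0r//; exact: leq_trans (ltn_ord l) niS.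
  rewrite gtn_eqF// (leq_trans (ltn_ord j))// (leq_trans niS)// addnS -addSn.
  exact: leq_addr.
rewrite (bigD1 (Ordinal iSn))//= mxE eqxx mul1r IHs/= addSnnS.
rewrite big1 ?addr0// => l lS; rewrite mxE eq_sym.
by rewrite (_ : (_ == _) = false) ?mul0r//; apply: negbTE.
Qed.

Lemma jordan_blockXn n : jordan_block n ^+ n = 0.
Proof.
apply/matrixP => i j; rewrite jordan_blockX mxE gtn_eqF//.
by rewrite (leq_trans (ltn_ord j))// leq_addl.
Qed.

Definition nil_jordan n :=
  NilEnd (ex_intro (fun N => jordan_block n ^+ N = 0) n (jordan_blockXn n)).

Lemma tens_sumE V W i j u v :
  nmx (nil_tens V W) (mxtens_index (i, j)) (mxtens_index (u, v)) =
  nmx V i u * (j == v)%:R + (i == u)%:R * nmx W j v.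
Proof. by rewrite mxE !tensmxE !mxE. Qed.

Lemma nil_tens_iso U V W Z : nilEnd_iso U V -> nilEnd_iso W Z ->
  nilEnd_iso (nil_tens U W) (nil_tens V Z).
Proof.
move=> [P [Q [PQ QP AP]]] [P' [Q' [PQ' QP' AP']]].
exists (P *t P'), (Q *t Q'); split.
- by rewrite tensmx_mul PQ PQ' tens11.
- by rewrite tensmx_mul QP QP' tens11.
- by rewrite mulmxDl mulmxDr !tensmx_mul !mul1mx !mulmx1 AP AP'.
Qed.

Lemma nil_tensC U V : nilEnd_iso (nil_tens U V) (nil_tens V U).
Proof.
pose f m n (i : 'I_(m * n)) : 'I_(n * m) :=
  mxtens_index ((mxtens_unindex i).2, (mxtens_unindex i).1).
have fK m n : cancel (@f m n) (@f n m).
  by move=> i; case: (mxtens_indexP i) => a b; rewrite /f !mxtens_indexK.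
apply: (@nilEnd_iso_reindex (nil_tens U V) (nil_tens V U) _ _ (fK _ _) (fK _ _)).
move=> i j; case: (mxtens_indexP i) => a b; case: (mxtens_indexP j) => u v.
by rewrite /f !mxtens_indexK !tens_sumE addrC mulrC [X in _ + X]mulrC.
Qed.

Lemma nil_tensA U V W : nilEnd_iso (nil_tens U (nil_tens V W))
  (nil_tens (nil_tens U V) W).
Proof.
pose f m n q (i : 'I_(m * (n * q))) : 'I_(m * n * q) :=
  let: (a, b) := mxtens_unindex i in let: (b, c) := mxtens_unindex b in
  mxtens_index (mxtens_index (a, b), c).
pose g m n q (i : 'I_(m * n * q)) : 'I_(m * (n * q)) :=
  let: (a, c) := mxtens_unindex i in let: (a, b) := mxtens_unindex a in
  mxtens_index (a, mxtens_index (b, c)).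
have fE m n q a b c : @f m n q (mxtens_index (a, mxtens_index (b, c))) =
    mxtens_index (mxtens_index (a, b), c) by rewrite /f !mxtens_indexK.
have gE m n q a b c : @g m n q (mxtens_index (mxtens_index (a, b), c)) =
    mxtens_index (a, mxtens_index (b, c)) by rewrite /g !mxtens_indexK.
apply: (@nilEnd_iso_reindex (nil_tens U (nil_tens V W))
  (nil_tens (nil_tens U V) W) (@f _ _ _) (@g _ _ _)).
- move=> i; case: (mxtens_indexP i) => a b; case: (mxtens_indexP b) => {}b c.
  by rewrite fE gE.
- move=> i; case: (mxtens_indexP i) => b c; case: (mxtens_indexP b) => {b}a b.
  by rewrite gE fE.
move=> i j; case: (mxtens_indexP i) => a b; case: (mxtens_indexP b) => {}b c.
case: (mxtens_indexP j) => u v; case: (mxtens_indexP v) => {}v w.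
rewrite !fE (@tens_sumE U (nil_tens V W)) (@tens_sumE (nil_tens U V) W).
rewrite !tens_sumE !(can_eq (@mxtens_indexK _ _)) !xpair_eqE -!mulnb !natrM.
by rewrite mulrDl mulrDr !mulrA addrA.
Qed.

Lemma nil_tens1 V : nilEnd_iso (nil_tens (nil_jordan 1) V) V.
Proof.
apply: (@nilEnd_iso_reindex (nil_tens (nil_jordan 1) V) V
  (fun i => (mxtens_unindex i).2) (fun i => mxtens_index (ord0, i))).
- move=> i; case: (mxtens_indexP i) => a b.
  by rewrite mxtens_indexK (ord1 a).
- by move=> i; rewrite mxtens_indexK.
move=> i j; case: (mxtens_indexP i) => a b; case: (mxtens_indexP j) => u v.
rewrite !mxtens_indexK (tens_sumE a b u v) mxE (ord1 a) (ord1 u)/=.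
by rewrite mul0r add0r mul1r.
Qed.

Lemma nil_dsumE V W i j : nmx (nil_dsum V W) (unsplit i) (unsplit j) =
  match i, j with
  | inl a, inl b => nmx V a b | inr a, inr b => nmx W a b | _, _ => 0 end.
Proof.
case: i => a; case: j => b /=;
by rewrite ?(block_mxEul, block_mxEur, block_mxEdl, block_mxEdr) ?mxE.
Qed.

Lemma nil_tensDr U V W : nilEnd_iso (nil_tens U (nil_dsum V W))
  (nil_dsum (nil_tens U V) (nil_tens U W)).
Proof.
pose f m n q (i : 'I_(m * (n + q))) : 'I_(m * n + m * q) :=
  let: (a, b) := mxtens_unindex i in unsplit
  match fintype.split b with inl b => inl (mxtens_index (a, b))
  | inr b => inr (mxtens_index (a, b)) end.
pose g m n q (i : 'I_(m * n + m * q)) : 'I_(m * (n + q)) :=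
  match fintype.split i with
  | inl i => let: (a, b) := mxtens_unindex i in mxtens_index (a, unsplit (inl b))
  | inr i => let: (a, b) := mxtens_unindex i in mxtens_index (a, unsplit (inr b))
  end.
have fE m n q a b : @f m n q (mxtens_index (a, unsplit b)) = unsplit
    match b with inl b => inl (mxtens_index (a, b))
    | inr b => inr (mxtens_index (a, b)) end.
  by rewrite /f mxtens_indexK unsplitK.
apply: (@nilEnd_iso_reindex (nil_tens U (nil_dsum V W))
  (nil_dsum (nil_tens U V) (nil_tens U W)) (@f _ _ _) (@g _ _ _)).
- move=> i; case: (mxtens_indexP i) => a b; rewrite -[b]splitK fE /g unsplitK.
  by case: (fintype.split b) => c; rewrite mxtens_indexK.
- move=> i; rewrite -[i in RHS]splitK /g; case: (fintype.split i) => j.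
    by case: (mxtens_indexP j) => a b; rewrite mxtens_indexK fE.
  by case: (mxtens_indexP j) => a b; rewrite mxtens_indexK fE.
move=> i j; case: (mxtens_indexP i) => a b; case: (mxtens_indexP j) => u v.
rewrite -[b]splitK -[v]splitK !fE (@nil_dsumE (nil_tens U V) (nil_tens U W)).
rewrite (@tens_sumE U (nil_dsum V W)) nil_dsumE (can_eq (@unsplitK _ _)).
case: (fintype.split b) => c; case: (fintype.split v) => w;
  by rewrite ?tens_sumE//= ?mulr0 ?addr0.
Qed.
End NilEnd.

Section ConvolutionRing.
Variable k : fieldType.

Definition iso_mul (c d : isoClass k) : isoClass k :=
  iso_class (nil_tens (iso_repr c) (iso_repr d)).

Lemma iso_mulE V W :
  iso_mul (iso_class V) (iso_class W) = iso_class (nil_tens V W).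
Proof. by apply/iso_classP/nil_tens_iso; apply: iso_reprE. Qed.

Lemma iso_mulA : associative iso_mul.
Proof.
move=> a b c; rewrite -[a]iso_reprK -[b]iso_reprK -[c]iso_reprK !iso_mulE.
exact/iso_classP/nil_tensA.
Qed.

Lemma iso_mulC : commutative iso_mul.
Proof.
move=> a b; rewrite -[a]iso_reprK -[b]iso_reprK !iso_mulE.
exact/iso_classP/nil_tensC.
Qed.

Lemma iso_mul1 : left_id (iso_class (nil_jordan k 1)) iso_mul.
Proof. by move=> a; rewrite -[a]iso_reprK iso_mulE; apply/iso_classP/nil_tens1. Qed.

(* The relations [V (+) W] = [V] + [W]. *)
Definition dsum_rel : set {freeg (isoClass k)} :=
  [set d | exists V W : nilEnd k,
    d = << iso_class (nil_dsum V W) >> - << iso_class V >> - << iso_class W >>].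

Lemma dsum_relM x d : dsum_rel d ->
  zspan dsum_rel (fglift (fun y => << iso_mul x y >> : {freeg (isoClass k)}) d).
Proof.
move=> [V [W ->]]; rewrite -[x]iso_reprK; set U := iso_repr x; apply: zspan_gen.
exists (nil_tens U V), (nil_tens U W).
rewrite !lift_is_additive !liftU !scale1r !iso_mulE; congr (<< _ >> - _ - _).
exact/iso_classP/nil_tensDr.
Qed.

Definition convPres : ringPres :=
  RingPres iso_mulA iso_mulC iso_mul1 dsum_relM.

Definition convRing : Type := presRing convPres.
HB.instance Definition _ := GRing.ComPzRing.on convRing.

Definition nclass (V : nilEnd k) : convRing := @pclass convPres (iso_class V).

(* The class f_n; f_0 is the class of the zero space, i.e. 0. *)
Definition jclass (n : nat) : convRing := nclass (nil_jordan k n).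

Lemma nclass_iso V W : nilEnd_iso V W -> nclass V = nclass W.
Proof. by move=> /iso_classP VW; rewrite /nclass VW. Qed.

Lemma nclassD V W : nclass (nil_dsum V W) = nclass V + nclass W.
Proof.
apply/eqP; rewrite -subr_eq0 opprD addrA; apply/eqP.
rewrite /nclass /pclass -!raddfB; apply: (@pi_span convPres).
by apply: zspan_gen; exists V, W.
Qed.

Lemma nclassM V W : nclass (nil_tens V W) = nclass V * nclass W.
Proof. by rewrite [RHS](@pres_mulE convPres) /= iso_mulE. Qed.

Lemma jclass1 : jclass 1 = 1. Proof. by []. Qed.

Definition nil_zero n : nilEnd k :=
  @NilEnd k n 0 (ex_intro _ 1%N (expr1 (0 : 'M[k]_n))).

Lemma nclass_zero n : nclass (nil_zero n) = n%:R.
Proof.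
elim: n => [|n IHn].
  apply: (@addrI _ (nclass (nil_zero 0))); rewrite addr0 -nclassD.
  by apply: nclass_iso; exists 0, 0; split; apply/matrixP => -[].
rewrite mulrS -IHn -jclass1 -nclassD; apply/esym/nclass_iso.
apply: (@nilEnd_iso_reindex _ (nil_dsum (nil_jordan k 1) (nil_zero n))
  (nil_zero n.+1) id id) => // i j.
rewrite [RHS]mxE /= (_ : jordan_block k 1 = 0) ?block_mx0 ?mxE//.
by apply/matrixP => a b; rewrite !mxE (ord1 b).
Qed.

End ConvolutionRing.

(* For p-powers a <= b in characteristic p, the substitution y |-> y - x on
   k[x, y] / (x^a, y^b) turns multiplication by x + y into multiplication by y.
   Hence J_a (x) J_b is a direct sum of a copies of J_b. *)
Section JordanTensor.
Variables (k : fieldType) (a b : nat).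
Local Notation X := (jordan_block k a.+1 *t 1%:M : 'M_(a.+1 * b.+1)).
Local Notation Y := (1%:M *t jordan_block k b.+1 : 'M_(a.+1 * b.+1)).
Let e0 : 'I_(a.+1 * b.+1) := mxtens_index (ord0, ord0).

Lemma tens_sum m n (F : 'I_(m * n) -> k) :
  \sum_r F r = \sum_i \sum_j F (mxtens_index (i, j)).
Proof.
rewrite pair_bigA (reindex (@mxtens_index m n))/=; last first.
  by exists (@mxtens_unindex m n) => i _; rewrite (mxtens_indexK, mxtens_unindexK).
by apply: eq_bigr => -[].
Qed.

Lemma jordan_sum n (t : 'I_n) (F : nat -> k) : F n = 0 ->
  \sum_v jordan_block k n t v * F v = F t.+1.
Proof.
move=> Fn; have [tn|nt] := ltnP t.+1 n.
  rewrite (bigD1 (Ordinal tn))//= mxE eqxx mul1r big1 ?addr0// => l lS.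
  rewrite mxE eq_sym (_ : (_ == _) = false) ?mul0r//; exact: negbTE.
have -> : t.+1 = n by apply/eqP; rewrite eqn_leq nt ltn_ord.
rewrite Fn big1// => v _; rewrite mxE gtn_eqF ?mul0r//.
exact: leq_trans (ltn_ord v) nt.
Qed.

Definition tens_subst (W : 'M[k]_(a.+1 * b.+1)) : 'M[k]_(a.+1 * b.+1) :=
  \matrix_(r, c) (X ^+ (mxtens_unindex r).1 * W ^+ (mxtens_unindex r).2) e0 c.

Lemma tens_substE W i j c :
  tens_subst W (mxtens_index (i, j)) c = (X ^+ i * W ^+ j) e0 c.
Proof. by rewrite mxE mxtens_indexK. Qed.

Lemma tens_substX W : GRing.comm X W -> X * tens_subst W = tens_subst W * X.
Proof.
move=> cXW; apply/matrixP => r c; case: (mxtens_indexP r) => i j {r}.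
rewrite -!mulmxE !mxE; under [RHS]eq_bigr do rewrite tens_substE.
transitivity ((X ^+ i * W ^+ j * X) e0 c); last by rewrite -mulmxE mxE.
rewrite -mulrA -(commrX _ cXW) mulrA -exprSr tens_sum.
transitivity (\sum_u jordan_block k a.+1 i u * (X ^+ u * W ^+ j) e0 c).
  apply: eq_bigr => u _; rewrite (bigD1 j)//= tensmxE tens_substE [1%:M _ _]mxE eqxx mulr1.
  rewrite big1 ?addr0// => v vj; rewrite tensmxE [1%:M _ _]mxE eq_sym (negbTE vj).
  by rewrite mulr0 mul0r.
rewrite (jordan_sum i (F := fun u => (X ^+ u * W ^+ j) e0 c))//.
by rewrite tensmx1X jordan_blockXn tens0mx mul0r mxE.
Qed.

Lemma tens_substY W : W ^+ b.+1 = 0 -> Y * tens_subst W = tens_subst W * W.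
Proof.
move=> W0; apply/matrixP => r c; case: (mxtens_indexP r) => i j {r}.
rewrite -!mulmxE !mxE; under [RHS]eq_bigr do rewrite tens_substE.
transitivity ((X ^+ i * W ^+ j * W) e0 c); last by rewrite -mulmxE mxE.
rewrite -mulrA -exprSr tens_sum (bigD1 i)//= [X in _ + X]big1 ?addr0 => [|u ui].
  under eq_bigr do rewrite tensmxE tens_substE [1%:M _ _]mxE eqxx mul1r.
  rewrite (jordan_sum j (F := fun v => (X ^+ i * W ^+ v) e0 c))//.
  by rewrite W0 mulr0 mxE.
rewrite big1// => v _; rewrite tensmxE [1%:M _ _]mxE eq_sym (negbTE ui).
by rewrite !mul0r.
Qed.

Lemma tens_monomial (i : 'I_a.+1) (j : 'I_b.+1) c :
  (X ^+ i * Y ^+ j) e0 c = (mxtens_index (i, j) == c)%:R.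
Proof.
rewrite tensmx1X tens1mxX -mulmxE tensmx_mul mulmx1 mul1mx.
case: (mxtens_indexP c) => u v; rewrite tensmxE !jordan_blockX.
by rewrite (can_eq (@mxtens_indexK _ _)) xpair_eqE -mulnb natrM.
Qed.

Lemma jordan_tens_iso (p i j : nat) : p \in [pchar k] -> (i <= j)%N ->
  a.+1 = (p ^ i)%N -> b.+1 = (p ^ j)%N ->
  nilEnd_iso (nil_tens (nil_jordan k a.+1) (nil_jordan k b.+1))
             (nil_tens (nil_zero k a.+1) (nil_jordan k b.+1)).
Proof.
move=> hp ij aE bE; have [p_pr /eqP p0] := andP hp.
have p0M : p%:R = 0 :> 'M[k]_(a.+1 * b.+1).
  by apply/matrixP => r c; rewrite mulmxnE -mulr_natr p0 mulr0 mxE.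
have cXY : GRing.comm X Y by exact: tens_comm.
have Xb : X ^+ b.+1 = 0.
  have /subnKC <- : (a.+1 <= b.+1)%N by rewrite aE bE leq_pexp2l// prime_gt0.
  by rewrite exprD tensmx1X jordan_blockXn tens0mx mul0r.
have Yb : Y ^+ b.+1 = 0 by rewrite tens1mxX jordan_blockXn tensmx0.
pose Z := X + Y; pose T := Y - X.
have cXZ : GRing.comm X Z by apply: commrD => //; exact: commr_refl.
have cXT : GRing.comm X T by apply: commrB => //; exact: commr_refl.
have Tb : T ^+ b.+1 = 0.
  have cYX : GRing.comm Y (- X) by apply/commrN/commr_sym.
  move: (pchar_commXD p_pr p0M j cYX); rewrite -bE => ->.
  by rewrite exprNn Yb Xb mulr0 addr0.
have XQ := tens_substX cXT; have YQ := tens_substY Tb.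
set Q := tens_subst T in XQ YQ.
have ZQ : Z * Q = Q * Y by rewrite mulrDl XQ YQ -mulrDr /T addrC subrK.
pose P := tens_subst Z.
have PQ : P *m Q = 1%:M.
  apply/matrixP => r c; case: (mxtens_indexP r) => u v {r}; rewrite !mxE.
  transitivity ((X ^+ u * Z ^+ v * Q) e0 c).
    by rewrite -mulmxE mxE; apply: eq_bigr => l _; rewrite tens_substE.
  have comX n : X ^+ n * Q = Q * X ^+ n.
    by elim: n => [|n IHn]; rewrite ?expr0 ?mulr1 ?mul1r// !exprSr -mulrA XQ mulrA IHn -mulrA.
  have comZ n : Z ^+ n * Q = Q * Y ^+ n.
    by elim: n => [|n IHn]; rewrite ?expr0 ?mulr1 ?mul1r// !exprSr -mulrA ZQ mulrA IHn -mulrA.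
  rewrite -mulrA comZ mulrA comX -mulrA -tens_monomial -mulmxE mxE.
  rewrite (bigD1 e0)//= big1 ?addr0 => [|l le0].
    by rewrite tens_substE !expr0 mulr1 -idmxE mxE eqxx mul1r.
  by rewrite tens_substE !expr0 mulr1 -idmxE mxE eq_sym (negbTE le0) mul0r.
exists Q, P; split => //=; first exact: mulmx1C.
by rewrite tens0mx add0r; exact: ZQ.
Qed.

End JordanTensor.

Section Rinfty.
Variable k : fieldType.

Lemma jclassM p i j : p \in [pchar k] -> (i <= j)%N ->
  jclass k (p ^ i) * jclass k (p ^ j) = jclass k (p ^ j) *+ p ^ i.
Proof.
move=> hp ij; have p_gt0 : (0 < p)%N by rewrite prime_gt0//; case/andP: hp.
have /prednK aE : (0 < p ^ i)%N by rewrite expn_gt0 p_gt0.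
have /prednK bE : (0 < p ^ j)%N by rewrite expn_gt0 p_gt0.
rewrite -nclassM -mulr_natl -nclass_zero -nclassM; apply: nclass_iso.
by rewrite -aE -bE; apply: (jordan_tens_iso hp ij).
Qed.

Definition Rsub (p nu : nat) : set (convRing k) :=
  zspan [set x | exists2 i, (i <= nu)%N & x = jclass k (p ^ i)].

Definition Rinf (p : nat) : set (convRing k) := \bigcup_nu Rsub p nu.

Lemma Rsub_le p m n : (m <= n)%N -> Rsub p m `<=` Rsub p n.
Proof.
move=> mn; apply: zspan_min; [exact: zspan0|exact: zspanB|].
by move=> _ [i im ->]; apply: zspan_gen; exists i => //; apply: leq_trans mn.
Qed.

Lemma zspanMn (G : zmodType) (S : set G) x n : zspan S x -> zspan S (x *+ n).
Proof.
move=> Sx; elim: n => [|n IHn]; first by rewrite mulr0n; apply: zspan0.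
by rewrite mulrS; apply: zspanD.
Qed.

Lemma RsubM p nu x y : p \in [pchar k] ->
  Rsub p nu x -> Rsub p nu y -> Rsub p nu (x * y).
Proof.
move=> hp hx hy; move: x hx; apply: zspan_min.
- by rewrite mul0r; apply: zspan0.
- by move=> u v hu hv; rewrite mulrBl; apply: zspanB.
move=> _ [i ile ->] /=; move: y hy; apply: zspan_min.
- by rewrite mulr0; apply: zspan0.
- by move=> u v hu hv; rewrite mulrBr; apply: zspanB.
move=> _ [j jle ->] /=; case/orP: (leq_total i j) => ij; last rewrite mulrC.
- by rewrite jclassM//; apply: zspanMn; apply: zspan_gen; exists j.
- by rewrite jclassM//; apply: zspanMn; apply: zspan_gen; exists i.
Qed.

Variables (p : nat) (hp : p \in [pchar k]).

(* The characteristic hypothesis plays no role in the underlying set; it is an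
   argument because it is what makes Rinf closed under multiplication. *)
Definition Rinf_pred of p \in [pchar k] : pred (convRing k) :=
  fun x => `[< Rinf p x >].

Lemma Rinf_pred_closed : subring_closed (Rinf_pred hp).
Proof.
split.
- apply/asboolP; exists 0 => //; apply: zspan_gen; exists 0 => //.
- move=> x y /asboolP[m _ hx] /asboolP[n _ hy]; apply/asboolP.
  exists (maxn m n) => //; apply: zspanB.
    exact: (Rsub_le (leq_maxl m n)).
  exact: (Rsub_le (leq_maxr m n)).
- move=> x y /asboolP[m _ hx] /asboolP[n _ hy]; apply/asboolP.
  exists (maxn m n) => //; apply: RsubM => //.
    exact: (Rsub_le (leq_maxl m n)).
  exact: (Rsub_le (leq_maxr m n)).
Qed.
HB.instance Definition _ :=
  GRing.isSubringClosed.Build (convRing k) (Rinf_pred hp) Rinf_pred_closed.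

Record Rinfty := MkRinfty {
  Rinfty_val : convRing k;
  _ : Rinfty_val \in Rinf_pred hp
}.
HB.instance Definition _ := [isSub for Rinfty_val].
HB.instance Definition _ := [Choice of Rinfty by <:].
HB.instance Definition _ := GRing.SubChoice_isSubComPzRing.Build (convRing k) (Rinf_pred hp)
  Rinfty Rinf_pred_closed.

End Rinfty.

Section TensorRing.
Variables A B : comPzRingType.
Implicit Types (x y : A * B).

(* A (x)_Z B as the free abelian group on A * B modulo biadditivity, with
   (a (x) b)(a' (x) b') = aa' (x) bb'. *)
Definition tensor_rel : set {freeg (A * B)%type} :=
  [set d | (exists a a' b, d = << (a + a', b) >> - << (a, b) >> - << (a', b) >>)
        \/ (exists a b b', d = << (a, b + b') >> - << (a, b) >> - << (a, b') >>)].

Definition pair_mul x y : A * B := (x.1 * y.1, x.2 * y.2).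

Lemma pair_mulA : associative pair_mul.
Proof. by move=> x y z; rewrite /pair_mul !mulrA. Qed.

Lemma pair_mulC : commutative pair_mul.
Proof. by move=> x y; rewrite /pair_mul mulrC [X in (_, X)]mulrC. Qed.

Lemma pair_mul1 : left_id (1, 1) pair_mul.
Proof. by move=> [a b]; rewrite /pair_mul !mul1r. Qed.

Lemma tensor_relM x d : tensor_rel d ->
  zspan tensor_rel (fglift (fun y => << pair_mul x y >> : {freeg (A * B)%type}) d).
Proof.
case: x => u v [[a [a' [b ->]]]|[a [b [b' ->]]]]; apply: zspan_gen;
  rewrite !lift_is_additive !liftU !scale1r /pair_mul /=.
- by left; exists (u * a), (u * a'), (v * b); rewrite mulrDr.
- by right; exists (u * a), (v * b), (v * b'); rewrite mulrDr.
Qed.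

Definition tensorRing : Type :=
  presRing (RingPres pair_mulA pair_mulC pair_mul1 tensor_relM).
HB.instance Definition _ := GRing.ComPzRing.on tensorRing.

End TensorRing.

Section Spec.
Variable A : comPzRingType.

Definition prime_ideal (P : set A) : Prop :=
  [/\ P 0, forall x y, P x -> P y -> P (x + y), forall a x, P x -> P (a * x),
      ~ P 1 & forall x y, P (x * y) -> P x \/ P y].

Record Spec := MkSpec { Spec_set :> set A; Spec_prime : prime_ideal Spec_set }.

Lemma Spec_eq (P Q : Spec) : Spec_set P = Spec_set Q -> P = Q.
Proof.
case: P Q => [P hP] [Q hQ] /= PQ; case: _ / PQ in hQ *.
by congr MkSpec; apply: Prop_irrelevance.
Qed.

HB.instance Definition _ := gen_eqMixin Spec.
HB.instance Definition _ := gen_choiceMixin Spec.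

(* The closed sets are the V(E) = {P | E contained in P}. *)
Definition zariski_open : set_system Spec :=
  [set U | exists E : set A, U = ~` [set P : Spec | E `<=` P]].

Lemma zariski_openT : zariski_open setT.
Proof.
exists setT; apply/esym/seteqP; split=> // P _ /= hP.
by have [_ _ _ P1 _] := Spec_prime P; apply/P1/hP.
Qed.

Lemma zariski_openI : setI_closed zariski_open.
Proof.
move=> _ _ [E ->] [F ->]; exists [set x | exists2 e, E e & exists2 f, F f & x = e * f].
apply/seteqP; split=> P /=.
- move=> [/existsNP[e /not_implyP[Ee Pe]] /existsNP[f /not_implyP[Ff Pf]]] EFP.
  have [_ _ _ _ /(_ e f)[]//] := Spec_prime P.
  by apply: EFP; exists e => //; exists f.
- have [_ _ PM _ _] := Spec_prime P.
  move=> nEF; split=> EP; apply: nEF => _ [e Ee [f Ff ->]].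
    by rewrite mulrC; apply: PM; apply: EP.
  by apply: PM; apply: EP.
Qed.

Lemma zariski_open_bigU (I : Type) (f : I -> set Spec) :
  (forall i, zariski_open (f i)) -> zariski_open (\bigcup_i f i).
Proof.
move=> fo; pose E i := projT1 (cid (fo i)).
have fE i : f i = ~` [set P : Spec | E i `<=` P] by rewrite /E; case: cid.
exists (\bigcup_i E i); apply/seteqP; split=> P /=.
  by move=> [i _]; rewrite fE => nEP hE; apply: nEP => x Ex; apply: hE; exists i.
move=> /existsNP[x /not_implyP[[i _ Eix] nPx]]; exists i => //.
by rewrite fE => EP; apply/nPx/EP.
Qed.

HB.instance Definition _ := isOpenTopological.Build Spec
  zariski_openT zariski_openI zariski_open_bigU.

Definition prime_chain (n : nat) (P : 'I_n.+1 -> Spec) : Prop :=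
  forall i j : 'I_n.+1, (i < j)%N -> Spec_set (P i) `<` Spec_set (P j).

(* d is the maximal length of a chain P_0 < ... < P_n of primes (in particular
   the spectrum is nonempty). *)
Definition krull_dim_is (d : nat) : Prop :=
  (exists P : 'I_d.+1 -> Spec, prime_chain P) /\
  forall (n : nat) (P : 'I_n.+1 -> Spec), prime_chain P -> (n <= d)%N.

End Spec.

Section SpecMap.
Variables (A B : comPzRingType) (f : {rmorphism A -> B}).

Fact Spec_map_subproof (P : Spec B) : prime_ideal (f @^-1` P).
Proof.
have [P0 PD PM P1 PP] := Spec_prime P; split; rewrite /preimage /=.
- by rewrite rmorph0.
- by move=> x y hx hy; rewrite rmorphD; apply: PD.
- by move=> a x hx; rewrite rmorphM; apply: PM.
- by rewrite rmorph1.
- by move=> x y; rewrite rmorphM; apply: PP.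
Qed.
Definition Spec_map (P : Spec B) : Spec A := MkSpec (Spec_map_subproof P).
End SpecMap.

Definition homeomorphism (X Y : topologicalType) (f : X -> Y) : Prop :=
  exists g : Y -> X, [/\ cancel f g, cancel g f, continuous f & continuous g].

Definition homeomorphic (X Y : topologicalType) : Prop :=
  exists f : X -> Y, homeomorphism f.

Section InverseLimit.

Definition Qpow (nu : nat) : Type := 'I_nu.+1 -> rat.
HB.instance Definition _ nu := GRing.ComPzRing.copy (Qpow nu) ('I_nu.+1 -> rat).

(* (a_0, ..., a_nu) |-> (a_0, ..., a_nu, a_nu) *)
Definition Qpow_ext (nu : nat) (a : Qpow nu) : Qpow nu.+1 :=
  fun i => if unlift ord_max i is Some j then a j else a ord_max.

Lemma Qpow_ext_zmod nu : zmod_morphism (@Qpow_ext nu).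
Proof.
move=> a b; apply: funext => i.
rewrite -[RHS]/(Qpow_ext a i - Qpow_ext b i) /Qpow_ext.
by case: (unlift _ _).
Qed.
HB.instance Definition _ nu :=
  GRing.isZmodMorphism.Build (Qpow nu) (Qpow nu.+1) (@Qpow_ext nu) (@Qpow_ext_zmod nu).

Lemma Qpow_ext_monoid nu : monoid_morphism (@Qpow_ext nu).
Proof.
split=> [|a b]; apply: funext => i.
  by rewrite -[RHS]/(1 : rat) /Qpow_ext; case: (unlift _ _).
rewrite -[RHS]/(Qpow_ext a i * Qpow_ext b i) /Qpow_ext.
by case: (unlift _ _).
Qed.
HB.instance Definition _ nu :=
  GRing.isMonoidMorphism.Build (Qpow nu) (Qpow nu.+1) (@Qpow_ext nu) (@Qpow_ext_monoid nu).

Definition Ystage (nu : nat) : topologicalType := Spec (Qpow nu).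

Definition Ytrans (nu : nat) : Ystage nu.+1 -> Ystage nu := Spec_map (@Qpow_ext nu).

(* The point given by the i-th projection to Q is the kernel of that projection. *)
Fact ystage_subproof nu (i : 'I_nu.+1) : prime_ideal [set a : Qpow nu | a i = 0].
Proof.
split=> /=.
- by [].
- by move=> x y xi yi; rewrite -[LHS]/(x i + y i) xi yi addr0.
- by move=> a x xi; rewrite -[LHS]/(a i * x i) xi mulr0.
- by move=> /eqP; apply/negP; exact: (oner_neq0 rat).
- move=> x y xyi; have /eqP : x i * y i = 0 by [].
  by rewrite mulf_eq0 => /orP[] /eqP; [left|right].
Qed.
Definition ystage nu (i : 'I_nu.+1) : Ystage nu := MkSpec (ystage_subproof i).

Definition Yset : set (prod_topology Ystage) :=
  [set y | forall nu, @Ytrans nu (y nu.+1) = y nu].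

Definition Ylim : topologicalType := set_type Yset.

Lemma Ytrans_ystage nu (i : 'I_nu.+2) : Ytrans (ystage i) =
  ystage (if unlift ord_max i is Some j then j else ord_max).
Proof.
by apply: Spec_eq; apply/seteqP; split=> a;
  rewrite /= /preimage /= /Qpow_ext; case: unlift.
Qed.

Fact ypt_subproof (i : nat) : Yset (fun nu => ystage (inord (minn i nu))).
Proof.
move=> nu; rewrite Ytrans_ystage; congr ystage; apply: val_inj.
have inordE n m : (m <= n)%N -> inord m = m :> nat := fun h => @inordK n m h.
case: unliftP => [[j jn] /(congr1 val)|/(congr1 val)] /=.
  rewrite !inordE ?geq_minr// /bump leqNgt jn add0n => ij.
  by move: jn; rewrite /=; lia.
by rewrite !inordE ?geq_minr//; lia.
Qed.
Definition ypt (i : nat) : Ylim := SigSub (mem_set (ypt_subproof i)).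

Fact yinf_subproof : Yset (fun nu => ystage ord_max).
Proof. by move=> nu; rewrite Ytrans_ystage unlift_none. Qed.
Definition yinf : Ylim := SigSub (mem_set yinf_subproof).

Lemma ystage_inj nu : injective (@ystage nu).
Proof.
move=> i j /(congr1 (@Spec_set _)) ij.
have : Spec_set (ystage i) (fun l => (l != i)%:R) by rewrite /= eqxx.
rewrite ij /=; case: eqVneq => [->//|_] /eqP.
by rewrite oner_eq0.
Qed.

Lemma ypt_inj : injective ypt.
Proof.
move=> i j /(congr1 (fun y : Ylim => set_val y (maxn i j))) /= /ystage_inj.
move=> /(congr1 (@nat_of_ord _)).
rewrite !inordK ?ltnS ?geq_minr//.
by rewrite (minn_idPl (leq_maxl _ _)) (minn_idPl (leq_maxr _ _)).
Qed.

End InverseLimit.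

(* Main.v *)
(* In A = R_infty (x) Q the elements g_j = f_{p^j} / p^j satisfy
   g_i g_j = g_max(i,j), so they form a decreasing sequence of idempotents with
   g_0 = 1 spanning A over Q.  A prime P is thus determined by the up-closed set
   {j | g_j in P}, that is by the character chi_i : A -> Q sending g_j to 1 for
   j <= i and to 0 otherwise (i <= infinity), of which P is the kernel.  All
   these characters exist: chi_i is induced by the total size of the Jordan
   blocks whose size is one of 1, p, ..., p^i, which is an additive invariant
   because block multiplicities are read off the ranks of powers, and
   chi_infty is induced by the dimension.  Every x in A satisfies
   chi_i(x) = chi_infty(x) for i large, whereas g_i - g_{i+1} isolates the i-th
   point and g_n cuts out the points of index >= n.  Hence Spec A is the
   one-point compactification of the discrete space N, and the coordinates
   min(i, nu) of the points of Y show the same for Y. *)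
Require Import Defs.
From HB Require Import structures.
From mathcomp Require Import all_boot all_order all_algebra.
From mathcomp Require Import all_classical topology function_spaces.
From mathcomp.multinomials Require Import freeg.
From mathcomp Require Import zify ring.

Set Implicit Arguments.
Unset Strict Implicit.
Unset Printing Implicit Defensive.

Import GRing.Theory.
Local Open Scope classical_set_scope.
Local Open Scope ring_scope.

(** * Additive induction on a presented ring *)

Lemma zmod_closed_sum (G : zmodType) (H : set G) (I : Type) (r : seq I)
    (F : I -> G) (m : I -> int) : H 0 -> (forall x y, H x -> H y -> H (x - y)) ->
  (forall i, H (F i)) -> H (\sum_(i <- r) F i *~ m i).
Proof.
move=> H0 HB HF.
have HN x : H x -> H (- x) by rewrite -sub0r; exact: HB.
have HD x y : H x -> H y -> H (x + y).
  by move=> hx /HN; rewrite -{2}[y]opprK; exact: HB.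
have HMn x n : H x -> H (x *+ n).
  by move=> hx; elim: n => [|n IHn]; rewrite ?mulr0n// mulrS; exact: HD.
elim/big_rec: _ => // i x _ hx; apply: HD => //.
by case: (m i) => n; [apply: HMn|apply/HN/HMn].
Qed.

(** A representative in the free abelian group is an integer combination of generators, so [q] is
    the same combination of their classes. *)
Lemma pclass_ind (P : ringPres) (H : set (presRing P)) : H 0 ->
  (forall x y, H x -> H y -> H (x - y)) -> (forall x, H (pclass x)) ->
  forall q, H q.
Proof.
move=> H0 HB Hc q; pose d := repr (q : {ideal_quot (zspan_sub (prel P))}).
rewrite (_ : q = \sum_(x <- dom d) pclass x *~ coeff x d).
  exact: zmod_closed_sum.
rewrite -[LHS]reprK -/d -[in LHS](freeg_sumE d) raddf_sum.
by apply: eq_bigr => x _; rewrite -[coeff x d]intz -freegU_mulz raddfMz intz.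
Qed.

(** * The tensor product over the integers and its universal property *)

Section TensorRingTheory.
Variables A B : comPzRingType.

Let pres := RingPres (@Defs.pair_mulA A B) (@Defs.pair_mulC A B)
  (@Defs.pair_mul1 A B) (@tensor_relM A B).

Definition tens (a : A) (b : B) : tensorRing A B := @pclass pres (a, b).

Lemma tensM a a' b b' : tens a b * tens a' b' = tens (a * a') (b * b').
Proof. exact: (@pres_mulE pres). Qed.

Lemma tens1 : tens 1 1 = 1. Proof. by []. Qed.

Lemma tensDl a a' b : tens (a + a') b = tens a b + tens a' b.
Proof.
apply/eqP; rewrite -subr_eq0 opprD addrA; apply/eqP.
rewrite /tens /pclass -!raddfB; apply: (@pi_span pres).
by apply: zspan_gen; left; exists a, a', b.
Qed.

Lemma tensDr a b b' : tens a (b + b') = tens a b + tens a b'.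
Proof.
apply/eqP; rewrite -subr_eq0 opprD addrA; apply/eqP.
rewrite /tens /pclass -!raddfB; apply: (@pi_span pres).
by apply: zspan_gen; right; exists a, b, b'.
Qed.

Lemma tens0 b : tens 0 b = 0.
Proof. by apply: (@addrI _ (tens 0 b)); rewrite -tensDl !addr0. Qed.

Lemma tensr0 a : tens a 0 = 0.
Proof. by apply: (@addrI _ (tens a 0)); rewrite -tensDr !addr0. Qed.

Lemma tensBl a a' b : tens (a - a') b = tens a b - tens a' b.
Proof. by apply/eqP; rewrite eq_sym subr_eq -tensDl subrK. Qed.

Lemma tensBr a b b' : tens a (b - b') = tens a b - tens a b'.
Proof. by apply/eqP; rewrite eq_sym subr_eq -tensDr subrK. Qed.

Lemma tensMn a b n : tens (a *+ n) b = tens a (b *+ n).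
Proof.
elim: n => [|n IHn]; first by rewrite !mulr0n tens0 tensr0.
by rewrite !mulrS tensDl tensDr IHn.
Qed.

Lemma tens_ind (H : set (tensorRing A B)) : H 0 ->
  (forall x y, H x -> H y -> H (x - y)) -> (forall a b, H (tens a b)) ->
  forall x, H x.
Proof.
by move=> H0 HB Ht; apply: (@pclass_ind pres) => // -[a b]; exact: Ht.
Qed.

Section Hom.
Variables (S : comPzRingType) (f : {rmorphism A -> S}) (g : {rmorphism B -> S}).

Let fg (x : pgen pres) : S := f x.1 * g x.2.

Let fg_rel (d : {freeg (pgen pres)}) : prel pres d -> @flift pres S fg d = 0.
Proof.
case=> [[a [a' [b ->]]]|[a [b [b' ->]]]];
  rewrite !fliftB !fliftE /fg /= rmorphD.
- by rewrite mulrDl addrAC addrK subrr.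
- by rewrite mulrDr addrAC addrK subrr.
Qed.

(** The universal property of the coproduct of commutative rings: [fg] is biadditive, so it descends
    from the free abelian group on pairs. *)
Definition tens_hom : tensorRing A B -> S := @plift pres S fg.

Lemma tens_homE a b : tens_hom (tens a b) = f a * g b.
Proof. by rewrite /tens_hom /tens (@pliftE pres). Qed.

Fact tens_hom_zmod : zmod_morphism tens_hom.
Proof. exact: (@pliftB pres). Qed.
HB.instance Definition _ :=
  GRing.isZmodMorphism.Build (tensorRing A B) S tens_hom tens_hom_zmod.

Fact tens_hom_monoid : monoid_morphism tens_hom.
Proof.
split=> [|x y]; first by rewrite -tens1 tens_homE !rmorph1 mulr1.
move: x; apply: tens_ind => [|u v hu hv|a b].
- by rewrite mul0r raddf0 mul0r.
- by rewrite mulrBl !raddfB mulrBl /= hu hv.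
move: y; apply: tens_ind => [|u v hu hv|a' b'].
- by rewrite mulr0 raddf0 mulr0.
- by rewrite mulrBr !raddfB mulrBr /= hu hv.
by rewrite tensM !tens_homE !rmorphM mulrACA.
Qed.
HB.instance Definition _ :=
  GRing.isMonoidMorphism.Build (tensorRing A B) S tens_hom tens_hom_monoid.

End Hom.
End TensorRingTheory.

(** * Ranks of powers and Jordan block multiplicities *)

Section JordanRank.
Variable k : fieldType.
Implicit Types V W : nilEnd k.

Definition nil_rank (s : nat) V : nat := \rank (nmx V ^+ s).

(** An intertwining map also intertwines the powers, and a product has rank at most that of each
    factor; symmetry gives equality. *)
Lemma nil_rank_iso s V W : nilEnd_iso V W -> nil_rank s V = nil_rank s W.
Proof.
suff le V' W' : nilEnd_iso V' W' -> (nil_rank s V' <= nil_rank s W')%N.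
  by move=> VW; apply/eqP; rewrite eqn_leq !le//; exact: nilEnd_iso_sym.
move=> [P [Q [PQ _ VP]]].
have VsP : nmx V' ^+ s *m P = P *m nmx W' ^+ s.
  elim: s => [|s IHs]; first by rewrite !expr0 -!idmxE mul1mx mulmx1.
  by rewrite !exprSr -!mulmxE -mulmxA VP mulmxA IHs mulmxA.
rewrite /nil_rank -[nmx V' ^+ s]mulmx1 -PQ mulmxA VsP.
by rewrite (leq_trans (mxrankM_maxl _ _))// mxrankM_maxr.
Qed.

Lemma nil_rank_dsum s V W :
  nil_rank s (nil_dsum V W) = (nil_rank s V + nil_rank s W)%N.
Proof.
rewrite /nil_rank -rank_diag_block_mx; congr (\rank _).
elim: s => [|s IHs]; first by rewrite !expr0 -!idmxE -scalar_mx_block.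
rewrite !exprS IHs -!mulmxE (mulmx_block (nmx V)).
by rewrite !mulmx0 !mul0mx !addr0 add0r.
Qed.

(** With D the projection on the first n - s coordinates, J^s = D J^s bounds the rank from above and
    D = J^s (J^s)^T bounds it from below. Truncated subtraction covers s > n. *)
Lemma nil_rank_jordan s n : nil_rank s (nil_jordan k n) = (n - s)%N.
Proof.
set J := jordan_block k n; pose D : 'M[k]_n := pid_mx (n - s).
have rD : \rank D = (n - s)%N by rewrite rank_pid_mx ?leq_subr.
have JD : J ^+ s = D *m J ^+ s.
  apply/matrixP => i j; rewrite mxE (bigD1 i)//= big1 ?addr0 => [|l li].
    rewrite mxE eqxx jordan_blockX ltn_subRL addnC /=.
    case: ltnP => [_|nis]; first by rewrite mul1r.
    by rewrite mul0r gtn_eqF// (leq_trans (ltn_ord j)).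
  by rewrite mxE eq_sym val_eqE (negbTE li) mul0r.
have DJ : D = J ^+ s *m (J ^+ s)^T.
  apply/matrixP => i j; rewrite mxE ltn_subRL addnC [RHS]mxE.
  under [RHS]eq_bigr do rewrite mxE !jordan_blockX.
  have [isn|nis] := ltnP (i + s) n; last first.
    rewrite andbF big1// => l _.
    by rewrite gtn_eqF ?mul0r// (leq_trans (ltn_ord l)).
  rewrite (bigD1 (Ordinal isn))//= eqxx mul1r eqn_add2r andbT eq_sym.
  rewrite big1 ?addr0// => l li; rewrite eq_sym.
  by rewrite (_ : (_ == _) = false) ?mul0r//; exact: negbTE.
apply/eqP; rewrite eqn_leq -rD /nil_rank /=; apply/andP; split.
  by rewrite -/J JD mxrankM_maxl.
by rewrite {1}DJ mxrankM_maxl.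
Qed.

(* The number of Jordan blocks of size m + 1. *)
Definition jordan_mult (m : nat) V : rat :=
  (nil_rank m V)%:R - (nil_rank m.+1 V)%:R *+ 2 + (nil_rank m.+2 V)%:R.

(** The truncated difference n - s is piecewise linear in s with its only corner at s = n, and
    [jordan_mult m] is its second difference centred at m + 1. *)
Lemma jordan_mult_jordan m n : jordan_mult m (nil_jordan k n) = (n == m.+1)%:R.
Proof.
rewrite /jordan_mult !nil_rank_jordan.
have [nm|mn|->] := ltngtP n m.+1.
- have [-> [-> ->]] : (n - m = 0 /\ n - m.+1 = 0 /\ n - m.+2 = 0)%N by lia.
  by rewrite !mulr0n mul0rn subrr.
- have [d ->] : exists d, n = (m.+2 + d)%N by exists (n - m.+2)%N; lia.
  have [-> [-> ->]] : (m.+2 + d - m = d.+2 /\ m.+2 + d - m.+1 = d.+1 /\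
    m.+2 + d - m.+2 = d)%N by lia.
  by rewrite -[d.+2]addn2 -[d.+1]addn1 !natrD mulr0n; ring.
- have [-> [-> ->]] : (m.+1 - m = 1 /\ m.+1 - m.+1 = 0 /\ m.+1 - m.+2 = 0)%N.
    by lia.
  by rewrite !mulr0n mul0rn subr0 addr0.
Qed.

Section IsoLift.
Variables (G : zmodType) (v : nilEnd k -> G).
Hypothesis v_iso : forall V W, nilEnd_iso V W -> v V = v W.
Hypothesis v_dsum : forall V W, v (nil_dsum V W) = v V + v W.

(** [v] is evaluated on a chosen representative of each isomorphism class; [v_iso] makes the choice
    immaterial, and [v_dsum] kills the relations. *)
Definition iso_lift : convRing k -> G := @plift (convPres k) G (v \o @iso_repr k).

Let v_rel (d : {freeg (pgen (convPres k))}) : prel (convPres k) d ->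
  @flift (convPres k) G (v \o @iso_repr k) d = 0.
Proof.
move=> [V [W ->]]; rewrite !fliftB !fliftE /=.
rewrite !(v_iso (iso_reprE _)) v_dsum.
by rewrite addrAC addrK subrr.
Qed.

Lemma iso_liftE V : iso_lift (nclass V) = v V.
Proof.
by rewrite /iso_lift /nclass (@pliftE (convPres k))//= (v_iso (iso_reprE _)).
Qed.

Lemma iso_liftB : zmod_morphism iso_lift.
Proof. exact: (@pliftB (convPres k)). Qed.

End IsoLift.
End JordanRank.

(** * The characters and idempotents of the rationalised ring *)

Section Characters.
Variables (k : fieldType) (p : nat) (hp : p \in [pchar k]).
Implicit Types (o : option nat) (V W : nilEnd k).

Let p_gt1 : (1 < p)%N.
Proof. by apply: prime_gt1; case/andP: hp. Qed.

Let p_neq0 j : (p ^ j)%:R != 0 :> rat.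
Proof. by rewrite Num.Theory.pnatr_eq0 expn_eq0 negb_and -lt0n ltnW. Qed.

(** [option nat] encodes the naturals with infinity adjoined, [None] being infinity. *)
Definition upto o (j : nat) : bool := if o is Some i then (j <= i)%N else true.

Lemma upto_le o i j : (i <= j)%N -> upto o j -> upto o i.
Proof. by case: o => // n; exact: leq_trans. Qed.

Lemma uptoM o i j : (i <= j)%N -> upto o i && upto o j = upto o j.
Proof.
by move=> ij; case: (boolP (upto o j)) => [/(upto_le ij)->|]; rewrite ?andbF.
Qed.

(* Some i: the total size of the Jordan blocks whose size is one of
   p^0, ..., p^i; None: the dimension. *)
Definition nil_char o V : rat :=
  if o is Some i then \sum_(j < i.+1) (p ^ j)%:R * jordan_mult (p ^ j).-1 V
  else (nil_rank 0 V)%:R.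

Lemma nil_char_iso o V W : nilEnd_iso V W -> nil_char o V = nil_char o W.
Proof.
move=> VW; case: o => [i|] /=; last by rewrite (nil_rank_iso _ VW).
by apply: eq_bigr => j _; rewrite /jordan_mult !(nil_rank_iso _ VW).
Qed.

Lemma nil_char_dsum o V W :
  nil_char o (nil_dsum V W) = nil_char o V + nil_char o W.
Proof.
case: o => [i|] /=; last by rewrite nil_rank_dsum natrD.
rewrite -big_split /=; apply: eq_bigr => j _; rewrite -mulrDr; congr (_ * _).
by rewrite /jordan_mult !nil_rank_dsum !natrD; ring.
Qed.

Lemma nil_char_jordan o j :
  nil_char o (nil_jordan k (p ^ j)) = (p ^ j)%:R * (upto o j)%:R.
Proof.
case: o => [i|] /=; last by rewrite nil_rank_jordan subn0 mulr1.
(* The index (p^l).-1 undoes the shift in [jordan_mult], so the summand tests p^j = p^l, that is j =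
   l since p > 1. *)
under eq_bigr => l _.
  rewrite jordan_mult_jordan prednK ?expn_gt0 ?(ltnW p_gt1)// eqn_exp2l//.
  over.
rewrite -ltnS; have [ji|ij] := ltnP j i.+1.
  rewrite (bigD1 (Ordinal ji))//= eqxx big1 ?addr0// => l lj.
  by rewrite eq_sym (_ : (_ == _) = false) ?mulr0//; exact: negbTE.
rewrite big1 ?mulr0// => l _.
by rewrite gtn_eqF ?mulr0// (leq_trans (ltn_ord l)).
Qed.

Definition conv_char o : convRing k -> rat := iso_lift (nil_char o).

Lemma conv_charB o : zmod_morphism (conv_char o).
Proof. by apply: iso_liftB; [exact: nil_char_iso|exact: nil_char_dsum]. Qed.
HB.instance Definition _ o :=
  GRing.isZmodMorphism.Build (convRing k) rat (conv_char o) (conv_charB o).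

Lemma conv_char_jclass o j :
  conv_char o (jclass k (p ^ j)) = (p ^ j)%:R * (upto o j)%:R.
Proof.
rewrite -nil_char_jordan; apply: iso_liftE;
  [exact: nil_char_iso|exact: nil_char_dsum].
Qed.

Lemma Rinf_ind (H : set (convRing k)) : H 0 ->
  (forall x y, H x -> H y -> H (x - y)) -> (forall j, H (jclass k (p ^ j))) ->
  @Rinf k p `<=` H.
Proof.
by move=> H0 HB HJ x [nu _]; apply: zspan_min => // _ [j _ ->]; exact: HJ.
Qed.

(** By biadditivity only products of f_{p^i} and f_{p^j} with i <= j matter. There the product is
    p^i f_{p^j}, and j <= o forces i <= o. *)
Lemma conv_charM o : {in Rinf_pred hp &, {morph conv_char o : x y / x * y}}.
Proof.
move=> x y /asboolP hx /asboolP hy.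
move: x hx; apply: Rinf_ind => [|u v hu hv|i].
- by rewrite mul0r raddf0 mul0r.
- by rewrite mulrBl !raddfB mulrBl /= hu hv.
move: y hy; apply: Rinf_ind => [|u v hu hv|j].
- by rewrite mulr0 raddf0 mulr0.
- by rewrite mulrBr !raddfB mulrBr /= hu hv.
wlog ij : i j / (i <= j)%N => [hwlog|].
  have [/hwlog//|/ltnW/hwlog] := leqP i j.
  by rewrite mulrC => ->; rewrite mulrC.
rewrite (jclassM hp ij) raddfMn /= !conv_char_jclass.
by rewrite -[LHS]mulr_natl mulrACA -[(upto o i)%:R * _]natrM mulnb uptoM// mulrA.
Qed.

Definition Rinfty_char o (x : Rinfty hp) : rat := conv_char o (val x).

Fact Rinfty_char_zmod o : zmod_morphism (Rinfty_char o).
Proof. by move=> x y; exact: conv_charB. Qed.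
HB.instance Definition _ o := GRing.isZmodMorphism.Build (Rinfty hp) rat
  (Rinfty_char o) (Rinfty_char_zmod o).

Fact Rinfty_char_monoid o : monoid_morphism (Rinfty_char o).
Proof.
split=> [|x y]; rewrite /Rinfty_char.
  rewrite rmorph1 -jclass1 -(expn0 p) conv_char_jclass expn0 mul1r.
  by case: o.
exact: conv_charM (valP x) (valP y).
Qed.
HB.instance Definition _ o := GRing.isMonoidMorphism.Build (Rinfty hp) rat
  (Rinfty_char o) (Rinfty_char_monoid o).

Fact Rinfty_gen_subproof j : jclass k (p ^ j) \in Rinf_pred hp.
Proof. by apply/asboolP; exists j => //; apply: zspan_gen; exists j. Qed.
Definition Rinfty_gen j : Rinfty hp := MkRinfty (Rinfty_gen_subproof j).

Lemma Rinfty_char_gen o j :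
  Rinfty_char o (Rinfty_gen j) = (p ^ j)%:R * (upto o j)%:R.
Proof. exact: conv_char_jclass. Qed.

Local Notation A := (tensorRing (Rinfty hp) rat).

Definition Rq_char o : A -> rat := tens_hom (Rinfty_char o) idfun.
HB.instance Definition _ o := GRing.RMorphism.on (Rq_char o).

Definition Rq_idem j : A := tens (Rinfty_gen j) (p ^ j)%:R^-1.

Lemma Rq_char_idem o j : Rq_char o (Rq_idem j) = (upto o j)%:R.
Proof.
by rewrite /Rq_char tens_homE /= Rinfty_char_gen /= mulrAC divff ?mul1r.
Qed.

(** The factor p^i in f_{p^i} f_{p^j} = p^i f_{p^j} moves across the tensor sign and cancels the
    denominator of g_i. *)
Lemma Rq_idemM i j : (i <= j)%N -> Rq_idem i * Rq_idem j = Rq_idem j.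
Proof.
move=> ij; rewrite /Rq_idem tensM.
have -> : Rinfty_gen i * Rinfty_gen j = Rinfty_gen j *+ p ^ i.
  by apply: val_inj; rewrite rmorphM rmorphMn; exact: jclassM hp ij.
by rewrite tensMn -[_ * _ *+ _]mulr_natl mulrA divff ?mul1r.
Qed.

Definition Rq_scal (q : rat) : A := tens 1 q.

Lemma Rq_char_scal o q : Rq_char o (Rq_scal q) = q.
Proof. by rewrite /Rq_char tens_homE rmorph1 mul1r. Qed.

Lemma Rq_scalV q : q != 0 -> Rq_scal q^-1 * Rq_scal q = 1.
Proof. by move=> q0; rewrite tensM mul1r mulVf// tens1. Qed.

(** Every tensor is a sum of pure ones, and their first factors are integer combinations of the
    f_{p^j}; moreover f_{p^j} (x) q is the multiple q p^j of g_j. *)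
Lemma Rq_ind (H : set A) : H 0 -> (forall x y, H x -> H y -> H (x - y)) ->
  (forall j q, H (Rq_scal q * Rq_idem j)) -> forall x, H x.
Proof.
move=> H0 HB Hg; apply: tens_ind => // -[a ha] q.
have : @Rinf k p a by exact/asboolP.
(* The induction runs in the ambient convolution ring, so the membership proof needed to form the
   tensor is bound existentially. *)
pose S : set (convRing k) :=
  fun b => exists hb : b \in Rinf_pred hp, H (tens (MkRinfty hb : Rinfty hp) q).
suff sub : @Rinf k p `<=` S.
  move=> ra; have [ha' Ht] := sub a ra.
  by rewrite (_ : MkRinfty ha = MkRinfty ha')//; exact: val_inj.
apply: Rinf_ind => [|u v [hu Hu] [hv Hv]|j].
- have h0 : 0 \in Rinf_pred hp by exact: rpred0.
  exists h0; rewrite (_ : MkRinfty _ = 0) ?tens0//; exact: val_inj.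
- have huv : u - v \in Rinf_pred hp by exact: rpredB.
  exists huv; rewrite (_ : MkRinfty _ = MkRinfty hu - MkRinfty hv).
    by rewrite tensBl; exact: HB.
  exact: val_inj.
- exists (Rinfty_gen_subproof j); have := Hg j (q * (p ^ j)%:R).
  by rewrite tensM mul1r mulfK.
Qed.

End Characters.

(** * A common model of the three spaces *)

(* The topology of the one-point compactification of the discrete space nat,
   transported along a bijection f. *)
Definition opc_nat (X : topologicalType) (f : option nat -> X) : Prop :=
  bijective f /\ forall U : set X, open U <->
    (U (f None) -> exists n, forall i, (n <= i)%N -> U (f (Some i))).

(** Openness on either side depends only on the preimage in [option nat], so matching indices is a
    homeomorphism. Recording [h (f o) = g o] keeps track of the individual points. *)
Lemma opc_nat_homeo (X Y : topologicalType) (f : option nat -> X)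
    (g : option nat -> Y) : opc_nat f -> opc_nat g ->
  exists h : X -> Y, homeomorphism h /\ forall o, h (f o) = g o.
Proof.
move=> [[f' fK f'K] fO] [[g' gK g'K] gO]; exists (g \o f'); split; last first.
  by move=> o /=; rewrite fK.
exists (f \o g'); split => [x|y| |].
- by rewrite /= gK f'K.
- by rewrite /= fK g'K.
- apply/continuousP => U /gO UO; apply/fO => /=; rewrite /preimage /= fK.
  by move=> /UO[n Un]; exists n => i ni; rewrite fK; exact: Un.
- apply/continuousP => U /fO UO; apply/gO => /=; rewrite /preimage /= gK.
  by move=> /UO[n Un]; exists n => i ni; rewrite gK; exact: Un.
Qed.

(** * Rational points and basic open sets of a spectrum *)

Section RatPoints.
Variable A : comPzRingType.

Fact rat_point_subproof (f : {rmorphism A -> rat}) : prime_ideal [set x | f x = 0].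
Proof.
split=> [|x y /= fx fy|a x /= fx|/=|x y /=].
- exact: rmorph0.
- by rewrite rmorphD fx fy addr0.
- by rewrite rmorphM fx mulr0.
- by rewrite rmorph1 => /eqP; apply/negP; exact: oner_neq0.
- by rewrite rmorphM => /eqP; rewrite mulf_eq0 => /orP[] /eqP; [left|right].
Qed.
Definition rat_point (f : {rmorphism A -> rat}) : Spec A :=
  MkSpec (rat_point_subproof f).

Implicit Types P : Spec A.

Lemma Spec_mulr P a x : Spec_set P x -> Spec_set P (a * x).
Proof. by have [_ _ PM _ _] := Spec_prime P; exact: PM. Qed.

Lemma Spec_opp P x : Spec_set P x -> Spec_set P (- x).
Proof. by rewrite -mulN1r; exact: Spec_mulr. Qed.

Lemma Spec_sub P x y : Spec_set P x -> Spec_set P y -> Spec_set P (x - y).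
Proof.
by have [_ PD _ _ _] := Spec_prime P; move=> Px /Spec_opp; exact: PD.
Qed.

Lemma Spec_neq1 P : ~ Spec_set P 1.
Proof. by have [] := Spec_prime P. Qed.

(* Modulo P every x is the scalar f x, so P is the kernel of f. *)
Lemma rat_point_eq P (f : {rmorphism A -> rat}) (s : rat -> A) :
  (forall q, q != 0 -> s q^-1 * s q = 1) -> s 0 = 0 ->
  (forall x, Spec_set P (x - s (f x))) -> P = rat_point f.
Proof.
move=> sV s0 Px; apply: Spec_eq; apply/seteqP; split=> x /=; last first.
  by move=> fx; have := Px x; rewrite fx s0 subr0.
(* If f x were nonzero, P would contain the unit s (f x) = x - (x - s (f x)). *)
move=> Pxx; apply/eqP/negPn/negP => fx0; apply: (@Spec_neq1 P).
rewrite -(sV _ fx0); apply: Spec_mulr.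
by rewrite -[s _](subKr x); apply: Spec_sub.
Qed.

Lemma Spec_open_setP (U : set (Spec A)) : open U <->
  forall P, U P -> exists2 x, ~ Spec_set P x &
    forall Q : Spec A, ~ Spec_set Q x -> U Q.
Proof.
split=> [[E ->] P /= /existsNP[x /not_implyP[Ex Px]]|UO].
  by exists x => // Q Qx EQ; exact/Qx/EQ.
(* The complement of U is cut out by all x whose basic open set lies in U. *)
exists [set x | forall Q : Spec A, ~ Spec_set Q x -> U Q].
apply/seteqP; split=> P /=.
  by move=> /UO[x Px xU] EP; exact/Px/EP.
move=> /existsNP[x /not_implyP[xU Px]]; exact: xU.
Qed.

End RatPoints.

(** * Points and topology of the inverse limit Y *)

Section InverseLimitTopology.

(** The coordinate idempotents [d i] sum to 1, so P misses some [d i]. Then x i = 0 gives d i * x =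
    0 and hence x in P, while x i <> 0 makes [d i] a multiple of x. *)
Lemma ystage_surj nu (P : Ystage nu) : exists i, P = ystage i.
Proof.
pose d (i : 'I_nu.+1) : Qpow nu := fun j => (i == j)%:R.
suff [i Pi] : exists i, ~ Spec_set P (d i).
  exists i; apply: Spec_eq; apply/seteqP; split=> x /=.
    move=> Px; apply/eqP/negPn/negP => xi; apply: Pi.
    rewrite (_ : d i = (fun j => (i == j)%:R * (x i)^-1) * x); last first.
      apply: funext => j; rewrite -[RHS]/((i == j)%:R * (x i)^-1 * x j) /d.
      by case: eqP => [<-|_]; rewrite ?mul0r// mul1r mulVf.
    exact: Spec_mulr.
  move=> xi; have [_ _ _ _ /(_ (d i) x)[]//] := Spec_prime P.
  rewrite (_ : d i * x = 0); first by have [] := Spec_prime P.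
  apply: funext => j; rewrite -[LHS]/((i == j)%:R * x j) -[RHS]/(0 : rat).
  by case: eqP => [<-|_]; rewrite ?mul0r// xi mulr0.
apply: contrapT => /forallNP Pd; apply: (@Spec_neq1 _ P).
rewrite (_ : 1 = \sum_i d i).
  apply: big_ind => [|x y|i _]; [by have [] := Spec_prime P|
    by have [_ PD _ _ _] := Spec_prime P; exact: PD|].
  by apply: contrapT; exact: Pd.
apply: funext => j; have -> : (\sum_i d i) j = \sum_i d i j.
  by elim/big_rec2: _ => // i y x _ <-.
by rewrite /d (bigD1 j)//= eqxx big1 ?addr0// => i /negbTE->.
Qed.

Lemma open_ystage1 nu (i : 'I_nu.+1) : open [set @ystage nu i].
Proof.
apply/Spec_open_setP => _ ->; exists (fun j => (i == j)%:R) => /=.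
  by rewrite eqxx => /eqP; rewrite oner_eq0.
move=> Q; have [j ->] := ystage_surj Q => /= ij.
by case: eqP ij => // ->.
Qed.

Definition Ycoord nu (y : Ylim) : Ystage nu := set_val y nu.

Lemma Ycoord_continuous nu : continuous (@Ycoord nu).
Proof.
move=> y; apply: (@continuous_comp Ylim (prod_topology Ystage) (Ystage nu)
  set_val (@proj nat Ystage nu)).
  exact: (@initial_continuous Ylim (prod_topology Ystage)).
exact: proj_continuous.
Qed.

Definition Ypt (o : option nat) : Ylim := if o is Some i then ypt i else yinf.

Definition cut (o : option nat) (nu : nat) : nat :=
  if o is Some i then minn i nu else nu.

Lemma cut_le o nu : (cut o nu <= nu)%N.
Proof. by case: o => //= i; exact: geq_minr. Qed.

Lemma Ycoord_Ypt nu o : Ycoord nu (Ypt o) = ystage (inord (cut o nu)).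
Proof.
case: o => [i|] //; congr ystage; apply: val_inj => /=.
by rewrite inordK.
Qed.

Lemma Ypt_eq (y : Ylim) o :
  (forall nu, Ycoord nu y = ystage (inord (cut o nu))) -> y = Ypt o.
Proof.
move=> yE; apply: val_inj; apply: functional_extensionality_dep => nu.
by rewrite -[LHS]/(Ycoord nu y) yE -Ycoord_Ypt.
Qed.

(** The transition map merges the last two points of a stage and fixes the other indices, so
    compatibility of the coordinates reads c nu = min(c (nu + 1), nu). *)
Lemma Ylim_index (y : Ylim) :
  exists c : nat -> nat, [/\ forall nu, Ycoord nu y = ystage (inord (c nu)),
    forall nu, (c nu <= nu)%N & forall nu, c nu = minn (c nu.+1) nu].
Proof.
have ex nu : exists i : 'I_nu.+1, Ycoord nu y = ystage i by exact: ystage_surj.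
pose i nu := projT1 (cid (ex nu)).
have iE nu : Ycoord nu y = ystage (i nu) by rewrite /i; case: cid.
exists (fun nu => nat_of_ord (i nu)); split=> nu.
- by rewrite inord_val.
- by rewrite -ltnS.
have : @Ytrans nu (Ycoord nu.+1 y) = Ycoord nu y by exact: (set_mem (svalP y)).
rewrite !iE Ytrans_ystage => /ystage_inj <-.
case: unliftP => [j ->|->] /=; last by rewrite (minn_idPr _)//.
by rewrite /bump leqNgt ltn_ord add0n (minn_idPl _)// -ltnS.
Qed.

(** Either c nu = nu throughout, which is the point at infinity, or c nu < nu for some nu, and from
    there on c is constant. *)
Lemma Ypt_surj (y : Ylim) : exists o, y = Ypt o.
Proof.
have [c [yE c_le cS]] := Ylim_index y.
have cD nu m : c nu = minn (c (m + nu)%N) nu.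
  elim: m nu => [|m IHm] nu; first by rewrite add0n; have := c_le nu; lia.
  by rewrite IHm (cS (m + nu)%N) addSn; lia.
have [[nu cnu]|/forallNP cnu] := pselect (exists nu, c nu < nu)%N; last first.
  exists None; apply: Ypt_eq => nu; rewrite yE /=; congr (ystage (inord _)).
  by have := c_le nu; have := cnu nu; lia.
exists (Some (c nu)); apply: Ypt_eq => m; rewrite yE /=; congr (ystage (inord _)).
(* Compatibility of m and nu is used in both directions: the first instance settles m <= nu, the
   second m > nu. *)
have := cD m (nu - m)%N; have := cD nu (m - nu)%N; have := c_le m.
have [mn|nm] := leqP m nu; first by rewrite (subnK mn); lia.
by rewrite (subnK (ltnW nm)); lia.
Qed.

Lemma Ypt_coord nu o o' : Ycoord nu (Ypt o) = Ycoord nu (Ypt o') ->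
  cut o nu = cut o' nu.
Proof.
rewrite !Ycoord_Ypt => /ystage_inj /(congr1 (@nat_of_ord _)).
by rewrite !inordK ?ltnS ?cut_le.
Qed.

Lemma Ypt_inj : injective Ypt.
Proof.
move=> o o' oo'; have {oo'} : forall nu, cut o nu = cut o' nu.
  by move=> nu; apply: Ypt_coord; rewrite oo'.
case: o o' => [i|] [j|] //= h.
(* Coordinate max(i, j) separates i from j, and coordinate i + 1 separates i from infinity. *)
- by congr Some; have := h (maxn i j); lia.
- by have := h i.+1; lia.
- by have := h j.+1; lia.
Qed.

(** Convergence is tested on coordinates, and the coordinate nu of [ypt i] agrees with that of
    [yinf] as soon as i >= nu. *)
Lemma ypt_cvg : ypt @ \oo --> yinf.
Proof.
move=> U [_ [[W Wo <-] Winf WU]]; apply: (filterS WU).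
suff : (fun i => set_val (ypt i)) @ \oo --> (set_val yinf : prod_topology Ystage).
  by apply; apply: open_nbhs_nbhs.
apply/cvg_sup => nu U' [_ [[V Vo <-] Vinf VU']]; apply: (filterS VU').
have inE i : (nu <= i)%N -> Ycoord nu (Ypt (Some i)) = Ycoord nu (Ypt None).
  by move=> nui; rewrite !Ycoord_Ypt /= (minn_idPr nui).
exists nu => // i /= /inE; rewrite /Ycoord /preimage /= => ->; exact: Vinf.
Qed.

Lemma Ypt_opc_nat : opc_nat Ypt.
Proof.
split.
  pose g y := projT1 (cid (Ypt_surj y)).
  have gE y : y = Ypt (g y) by rewrite /g; case: cid.
  by exists g => [o|y] //; apply: Ypt_inj; rewrite -gE.
move=> U; split=> [Uo Uinf|UP].
  have [n _ nU] := ypt_cvg (open_nbhs_nbhs (conj Uo Uinf)).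
  by exists n => i /= ni; exact: nU.
rewrite openE => y; have [o ->] := Ypt_surj y => Uo.
(* One coordinate suffices for a neighbourhood: coordinate i + 1 isolates the point i, and
   coordinate n cuts out infinity together with all indices >= n. *)
have [nu nuU] : exists nu, forall o', cut o' nu = cut o nu -> U (Ypt o').
  case: o Uo => [i|] Uo.
  - exists i.+1 => o' h; rewrite (_ : o' = Some i)//.
    by case: o' h => [j|] /= h; [congr Some|]; lia.
  - have [n nU] := UP Uo.
    by exists n => -[i|] //= h; apply: nU; lia.
have : nbhs (Ypt o) (@Ycoord nu @^-1` [set Ycoord nu (Ypt o)]).
  apply: open_nbhs_nbhs; split=> //; rewrite Ycoord_Ypt.
  by move/continuousP: (@Ycoord_continuous nu); apply; exact: open_ystage1.
apply: filterS => z; have [o' ->] := Ypt_surj z; move=> /Ypt_coord.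
exact: nuU.
Qed.

End InverseLimitTopology.

(** * The one-point compactification of the discrete points *)

Section OnePoint.

(** The sets where h < n are open and increase to the whole space, so compactness, in its
    near-covering form along n tending to infinity, yields one n. *)
Lemma discrete_compact_bounded (T : choiceType) (h : T -> nat)
    (C : set (discrete_topology T)) : compact C ->
  exists n, forall x, C x -> (h x < n)%N.
Proof.
move=> /compact_near_coveringP /(_ nat \oo (fun n x => (h x < n)%N) _).
case=> [x Cx|n _ nC]; last by exists n => x Cx; exact: (nC n (leqnn n)).
exists ([set x], [set n | (h x < n)%N]) => /=; last by move=> [y n] /= [-> ].
split; first exact: discrete_set1.
by exists (h x).+1.
Qed.

Local Notation X := (discrete_topology (range ypt)).

Definition opc_ypt (o : option nat) : one_point_compactification X :=
  if o is Some i then Some (SigSub (mem_set (imageP ypt (I : setT i)))) else None.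

(** Neighbourhoods of infinity contain the complement of a compact set. In the discrete space such a
    set has bounded indices, and conversely the finitely many points of index below n form a compact
    set. *)
Lemma opc_ypt_opc_nat : opc_nat opc_ypt.
Proof.
have idx (x : X) : exists i, Some x = opc_ypt (Some i).
  have [i _ ix] := set_mem (svalP x).
  by exists i; congr Some; apply: val_inj.
pose g x := projT1 (cid (idx x)).
have gE x : Some x = opc_ypt (Some (g x)) by rewrite /g; case: cid.
have opc_inj i j : opc_ypt (Some i) = opc_ypt (Some j) -> i = j.
  move=> /(congr1 (fun x =>
    if x is Some y then set_val (y : range ypt) else yinf)).
  exact: ypt_inj.
have gK i : g (SigSub (mem_set (imageP ypt (I : setT i)))) = i.
  by apply: opc_inj; rewrite -gE.
split.
  exists (omap g) => [[i|]|[x|]] //=; by rewrite gK.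
move=> U; split=> [|UP].
  rewrite openE => UO /UO [C [/(discrete_compact_bounded g)[n Cn] _] CU].
  exists n => i ni; apply: CU; left => /=.
  exists (SigSub (mem_set (imageP ypt (I : setT i)))) => // /Cn.
  by rewrite gK ltnNge ni.
rewrite openE => -[x|] Ux.
  suff : principal_filter x [set z | U (Some z)] by [].
  exact/principal_filterP.
have [n nU] := UP Ux; exists [set x | (g x < n)%N].
  split; last exact: discrete_closed.
  apply: finite_compact.
  apply: (@sub_finite_set _ _
    ((fun i => SigSub (mem_set (imageP ypt (I : setT i))) : X) @` `I_n)).
    move=> x /= gx; exists (g x) => //; have := gE x.
    by case.
  exact/finite_image/finite_II.
move=> _ [[x /negP gx <-]|->//]; rewrite gE; apply: nU.
by rewrite leqNgt.
Qed.

End OnePoint.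

(** * The prime spectrum of the rationalised ring *)

Section SpecCharacters.
Variables (k : fieldType) (p : nat) (hp : p \in [pchar k]).
Local Notation A := (tensorRing (Rinfty hp) rat).
Local Notation chi := (@Rq_char k p hp).
Local Notation g := (@Rq_idem k p hp).
Implicit Types P Q : Spec A.

Definition Rq_point (o : option nat) : Spec A := rat_point (chi o).

Lemma Rq_idem_dichotomy P i : Spec_set P (g i) \/
  Spec_set P (1 - g i).
Proof.
have [P0 _ _ _ PP] := Spec_prime P; apply: PP.
by rewrite mulrBr mulr1 Rq_idemM// subrr.
Qed.

Lemma Rq_idem_le P i j : (i <= j)%N -> Spec_set P (g i) ->
  Spec_set P (g j).
Proof. by move=> ij Pi; rewrite -(Rq_idemM hp ij) mulrC; exact: Spec_mulr. Qed.

(** Modulo P each g_j is 0 or 1, here with the same value as under [chi o]. As the g_j span over the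
    rationals, every x is congruent to the scalar chi o x. *)
Lemma Rq_point_eq P o :
  (forall j, Spec_set P (g j) <-> ~~ upto o j) -> P = Rq_point o.
Proof.
move=> Po; apply: (@rat_point_eq _ _ _ (@Rq_scal k p hp)) => [q q0| |x].
- exact: Rq_scalV.
- exact: tensr0.
have P0 : Spec_set P 0 by have [] := Spec_prime P.
move: x; apply: Rq_ind => [|x y hx hy|j q].
- by rewrite raddf0 /Rq_scal tensr0 subrr.
- rewrite raddfB /Rq_scal tensBr opprD addrACA -opprD; exact: Spec_sub.
rewrite rmorphM /= Rq_char_scal Rq_char_idem.
case: (boolP (upto o j)) => [jo|/(Po j).2 Pj].
  rewrite mulr1 -[X in _ - X]mulr1 -mulrBr; apply: Spec_mulr.
  rewrite -opprB; apply: Spec_opp.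
  by have [/(Po j).1|//] := Rq_idem_dichotomy P j; rewrite jo.
by rewrite mulr0 /Rq_scal tensr0 subr0; exact: Spec_mulr.
Qed.

Lemma Rq_point_surj P : exists o, P = Rq_point o.
Proof.
have P1 : ~ Spec_set P (g 0).
  move=> h; apply: (@Spec_neq1 _ P); move: h; congr (Spec_set P _).
  rewrite /Rq_idem expn0 invr1 -tens1; congr tens; exact: val_inj.
have [ex|/forallNP nex] := pselect (exists j, `[< Spec_set P (g j) >]);
    last first.
  exists None; apply: Rq_point_eq => j /=; split=> // h.
  by case: (nex j); exact/asboolP.
(* The least j with g_j in P is positive because g_0 = 1; its predecessor is the last index where
   the character takes the value 1. *)
exists (Some (ex_minn ex).-1); apply: Rq_point_eq => j /=.
case: ex_minnP => -[|m] /asboolP Pm mP //; rewrite -ltnNge /=; split.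
  by move=> Pj; apply: mP; exact/asboolP.
by move=> mj; exact: Rq_idem_le Pm.
Qed.

Lemma Rq_point_inj : injective Rq_point.
Proof.
move=> o o' oo'; have h j : upto o j = upto o' j.
  have : Spec_set (Rq_point o) (g j) <->
      Spec_set (Rq_point o') (g j) by rewrite oo'.
  rewrite /= !Rq_char_idem.
  have e (b : bool) : (b%:R = 0 :> rat) <-> ~~ b by case: b; split.
  by rewrite !e; case: (upto o j) (upto o' j) => [] [] // [] // a b;
    [have := b isT|have := a isT].
case: o o' {oo'} h => [i|] [j|] //= h.
- by congr Some; apply/eqP; rewrite eqn_leq -h leqnn h leqnn.
- by have := h i.+1; rewrite ltnn.
- by have := h j.+1; rewrite ltnn.
Qed.

(** Only finitely many g_j occur in x, and [chi (Some i)] agrees with [chi None] on g_j once i >=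
    j. *)
Lemma Rq_char_lim x : exists n, forall i, (n <= i)%N ->
  chi (Some i) x = chi None x.
Proof.
move: x; apply: Rq_ind => [|x y [m hx] [n hy]|j q].
- by exists 0%N => i _; rewrite !raddf0.
- exists (maxn m n) => i; rewrite geq_max => /andP[mi ni].
  by rewrite !raddfB /= hx ?hy.
by exists j => i ji; rewrite !rmorphM /= !Rq_char_scal !Rq_char_idem /= ji.
Qed.

Lemma Rq_point_opc_nat : opc_nat Rq_point.
Proof.
split.
  pose h y := projT1 (cid (Rq_point_surj y)).
  have hE y : y = Rq_point (h y) by rewrite /h; case: cid.
  by exists h => [o|y] //; apply: Rq_point_inj; rewrite -hE.
move=> U; split=> [/Spec_open_setP UO /UO[x /= x0 xU]|UP].
  have [n nx] := Rq_char_lim x; exists n => i ni; apply: xU => /=.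
  by rewrite nx.
apply/Spec_open_setP => P; have [o ->] := Rq_point_surj P => Uo.
(* The character of index j sends g_i - g_(i+1) to 1 if j = i and to 0 otherwise; g_n is nonzero
   exactly at infinity and at the indices >= n. *)
have [x xo xU] : exists2 x, chi o x <> 0 &
    forall o', chi o' x <> 0 -> U (Rq_point o').
  case: o Uo => [i|] Uo.
    exists (g i - g i.+1) => [|o']; rewrite raddfB /= !Rq_char_idem /=.
      by rewrite leqnn ltnn mulr0n subr0 => /eqP; rewrite oner_eq0.
    case: o' => [j|] /=; last by rewrite subrr.
    by have [_|_|<- //] := ltngtP i j; rewrite subrr.
  have [n nU] := UP Uo; exists (g n) => [|o']; rewrite Rq_char_idem /=.
    by move/eqP; rewrite oner_eq0.
  by case: o' => [j|] //=; case: leqP => // nj _; exact: nU.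
by exists x => // Q; have [o' ->] := Rq_point_surj Q; exact: xU.
Qed.

(** If g_j is not in P, then 1 - g_j lies in P and hence in Q, so g_j is not in Q either. Thus P and
    Q contain the same g_j. *)
Lemma Rq_point_max P Q : Spec_set P `<=` Spec_set Q -> P = Q.
Proof.
have [o ->] := Rq_point_surj P; move=> sPQ.
apply/esym/Rq_point_eq => j; split=> [Qj|/negbTE oj]; last first.
  by apply: sPQ; rewrite /= Rq_char_idem oj.
apply/negP => oj; apply: (@Spec_neq1 _ Q).
rewrite -[1](subrK (g j)); have [_ QD _ _ _] := Spec_prime Q.
apply: QD => //; apply: sPQ.
by rewrite /= raddfB /= rmorph1 Rq_char_idem oj subrr.
Qed.

Lemma Rq_krull_dim0 : krull_dim_is A 0.
Proof.
split=> [|n P Pc]; first by exists (fun=> Rq_point None) => i j; rewrite !ord1.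
rewrite leqNgt; apply/negP => n_gt0.
have [sub nsub] := Pc ord0 ord_max n_gt0.
by apply: nsub; rewrite (Rq_point_max sub).
Qed.

End SpecCharacters.

Theorem theorem5p1 (k : fieldType) (p : nat) (hp : p \in [pchar k]) :
  [/\ krull_dim_is (tensorRing (Rinfty hp) rat) 0,
      homeomorphic (Spec (tensorRing (Rinfty hp) rat)) Ylim
    & exists f : one_point_compactification (discrete_topology (range ypt)) ->
                 Ylim,
        [/\ homeomorphism f,
            forall y : range ypt, f (Some y) = set_val y
          & f None = yinf]].
Proof.
split; first exact: Rq_krull_dim0.
  have [h [hh _]] := opc_nat_homeo (Rq_point_opc_nat hp) Ypt_opc_nat.
  by exists h.
(* The homeomorphism matches indices, so it sends each y_i to itself and the added point to
   y_infinity. *)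
have [f [fh fE]] := opc_nat_homeo opc_ypt_opc_nat Ypt_opc_nat.
exists f; split => // [y|]; last exact: (fE None).
have [i _ iy] := set_mem (svalP y).
rewrite (_ : Some y = opc_ypt (Some i)) ?fE//.
by congr Some; apply: val_inj.
Qed.
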